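(* Let $\mathbf{g}=(\mathbf{g}^0;\mathbf{g}^+)$ with $\mathbf{g}^0=\{g_1^0,\dots,g_{n_1}^0\}$, $\mathbf{g}^+=\{g_1^+,\dots,g_{n_2}^+\}\subset\mathbb{R}[\mathbf{x}]$. There exists $t_2\in\mathbb{N}$ such that for all $t\ge t_2$ and all $\Lambda^*\in\mathcal{L}_t(\mathbf{g})$ optimal for $0$, we have $(\ker M^t_{\Lambda^*})=\mathcal{I}(\mathcal{S}(\mathbf{g}))=\sqrt[\mathbf{g}^+]{(\mathbf{g}^0)}$.
   Context: $\mathbf{x}=(x_1,\dots,x_n)$; $\mathbb{R}[\mathbf{x}]_k$ is the space of polynomials of degree $\le k$ ($\{0\}$ if $k<0$); $(B)$ is the ideal of $\mathbb{R}[\mathbf{x}]$ generated by $B$; $\mathcal{I}(\cdot)$ is the vanishing ideal in $\mathbb{R}[\mathbf{x}]$. $\mathcal{S}(\mathbf{g})=\{\mathbf{x}\in\mathbb{R}^n:g_i^0(\mathbf{x})=0\ \forall i,\ g_j^+(\mathbf{x})\ge0\ \forall j\}$. For $\epsilon\in\{0,1\}^{n_2}$ let $g^\epsilon=(g_1^+)^{\epsilon_1}\cdots(g_{n_2}^+)^{\epsilon_{n_2}}$. $\mathcal{P}^+(\mathbf{g})$ is the set of sums $\sum_\epsilon g^\epsilon s_\epsilon$ with $s_\epsilon$ sums of squares in $\mathbb{R}[\mathbf{x}]$. The $\mathbf{g}^+$-radical is $\sqrt[\mathbf{g}^+]{(\mathbf{g}^0)}=\{p\in\mathbb{R}[\mathbf{x}]:p^{2m}+q\in(\mathbf{g}^0)\text{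 for some }m\in\mathbb{N}\setminus\{0\},\ q\in\mathcal{P}^+(\mathbf{g})\}$. $\mathcal{Q}_t^+$ is the set of finite sums of squares of polynomials of degree $\le t$ ($\{0\}$ if $t<0$). $\mathcal{P}_t(\mathbf{g})=\{\sum_i g_i^0h_i+\sum_{\epsilon}g^\epsilon s_\epsilon: h_i\in\mathbb{R}[\mathbf{x}]_{2t-\deg g_i^0},\ s_\epsilon\in\mathcal{Q}^+_{t-\lceil\deg(g^\epsilon)/2\rceil}\}$. $\mathcal{L}_t(\mathbf{g})=\{\Lambda\in(\mathbb{R}[\mathbf{x}]_{2t})^*:\Lambda(p)\ge0\ \forall p\in\mathcal{P}_t(\mathbf{g}),\ \Lambda(1)=1\}$. For $\Lambda\in(\mathbb{R}[\mathbf{x}]_{2t})^*$, $M^t_\Lambda:\mathbb{R}[\mathbf{x}]_t\to(\mathbb{R}[\mathbf{x}]_t)^*$ is $M^t_\Lambda(p)(q)=\Lambda(pq)$. $\Lambda^*\in\mathcal{L}_t(\mathbf{g})$ is optimal for $0$ (the zero objective polynomial) if $\operatorname{rank}M^t_{\Lambda^*}=\max_{\Lambda\in\mathcal{L}_t(\mathbf{g})}\operatorname{rank}M^t_\Lambda$ (equivalently, $\ker M^t_{\Lambda^*}\subset\ker M^t_\Lambda$ for all $\Lambda\in\mathcal{L}_t(\mathbf{g})$). *)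

(* Defs.v *)
From HB Require Import structures.
From mathcomp Require Import all_boot all_order all_algebra.
From mathcomp Require Import classical_sets reals.
From mathcomp Require Import mpoly zify.

Set Implicit Arguments.
Unset Strict Implicit.
Unset Printing Implicit Defensive.

Import Order.TTheory GRing.Theory Num.Theory.

Local Open Scope classical_set_scope.
Local Open Scope ring_scope.

Section BoundedDegree.
Variables (n : nat) (R : fieldType).
Implicit Types p q : {mpoly R[n]}.

(* Total degree, with deg 0 = 0; in the definitions below the value at 0 is
   irrelevant, since there a vanishing polynomial only occurs as a factor. *)
Definition mpdeg p : nat := (msize p).-1.

(* For k < 0 only the zero polynomial (empty support) qualifies. *)
Definition degle (k : int) : {pred {mpoly R[n]}} :=
  fun p => all (fun m => (mdeg m)%:Z <= k) (msupp p).

Lemma degleP (k : int) p :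
  reflect (forall m, m \in msupp p -> (mdeg m)%:Z <= k) (p \in degle k).
Proof. exact: allP. Qed.

Lemma degle_nat (k : nat) p : (p \in degle k) = (msize p <= k.+1)%N.
Proof.
apply/degleP/idP => [h|h m mp].
  rewrite msizeE big_seq; apply: (big_ind (fun x => x <= k.+1)%N) => //.
    by move=> a b ha hb; rewrite geq_max ha hb.
by rewrite lez_nat -ltnS; apply: leq_trans h; apply: msize_mdeg_lt.
Qed.

Lemma degle_mpdeg (k : int) p :
  (p \in degle k) = (p == 0) || ((mpdeg p)%:Z <= k).
Proof.
have [->|p0] := eqVneq p 0; first by apply/degleP => m; rewrite msupp0.
case: k => k /=.
  rewrite degle_nat lez_nat /mpdeg.
  by move: p0; rewrite -msize_poly_eq0; case: (msize p).
by apply/negbTE/negP => /degleP /(_ _ (mlead_supp p0)).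
Qed.

Lemma degle_submod_closed k : submod_closed (degle k).
Proof.
split=> [|c p q /degleP hp /degleP hq]; first by apply/degleP => m; rewrite msupp0.
apply/degleP => m /msuppD_le; rewrite mem_cat => /orP[/msuppZ_le|]; [exact: hp|exact: hq].
Qed.

HB.instance Definition _ k :=
  GRing.isSubmodClosed.Build R {mpoly R[n]} (degle k) (degle_submod_closed k).

Definition polyle (k : nat) := {p : {mpoly R[n]} | p \in degle k}.

HB.instance Definition _ k := SubChoice.on (polyle k).
HB.instance Definition _ k := [SubChoice_isSubLmodule of polyle k by <:].

Lemma mcoeff_degle (k : nat) p (m : 'X_{1..n}) :
  p \in degle k -> ~~ (mdeg m < k.+1)%N -> p@_m = 0.
Proof.
move=> /degleP hp hm; apply: memN_msupp_eq0; apply/negP => /hp.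
by rewrite lez_nat -ltnS (negPf hm).
Qed.

Lemma polyle_vecaxiom (k : nat) :
  Vector.axiom #|{: 'X_{1..n < k.+1}}| (polyle k).
Proof.
pose f (p : polyle k) := \row_(i < #|{: 'X_{1..n < k.+1}}|) (val p)@_(enum_val i).
pose g0 (v : 'rV[R]_#|{: 'X_{1..n < k.+1}}|) : {mpoly R[n]} :=
  \sum_i v 0 i *: 'X_[enum_val i].
have g0P v : g0 v \in degle k.
  apply: rpred_sum => i _; apply: rpredZ; rewrite degle_nat msizeX.
  exact: bmdeg.
exists f.
  by move=> c p q; apply/rowP => i; rewrite !mxE /= linearP.
exists (fun v => exist _ (g0 v) (g0P v)).
- move=> p; apply: val_inj => /=; rewrite /g0.
  have /mpolywE -> : (msize (val p) <= k.+1)%N.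
    by rewrite -degle_nat; exact: valP.
  rewrite [RHS](reindex (@enum_val _ xpredT)) /=; last first.
    by apply: onW_bij; exact: enum_val_bij.
  by apply: eq_bigr => i _; rewrite mxE.
- move=> v; apply/rowP => i; rewrite mxE /= /g0 raddf_sum /=.
  rewrite (bigD1 i) //= big1 ?addr0 => [|j ji].
    by rewrite mcoeffZ mcoeffX eqxx mulr1.
  by rewrite mcoeffZ mcoeffX -bmeqP (inj_eq enum_val_inj) (negPf ji) mulr0.
Qed.

HB.instance Definition _ k :=
  Lmodule_hasFinDim.Build R (polyle k) (polyle_vecaxiom k).

Lemma degle1 (k : nat) : 1 \in degle k.
Proof. by rewrite degle_nat msize1. Qed.

Definition polyle1 k : polyle k := exist _ 1 (degle1 k).

Lemma degleM (a b : int) p q :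
  p \in degle a -> q \in degle b -> p * q \in degle (a + b).
Proof.
move=> /degleP hp /degleP hq; apply/degleP => m /msuppM_le/allpairsP[[m1 m2]] /=.
by case=> /hp h1 /hq h2 ->; rewrite mdegD PoszD lerD.
Qed.

Lemma degle_mul (t : nat) (p q : polyle t) :
  val p * val q \in degle (2 * t)%N.
Proof. by rewrite mul2n -addnn PoszD; apply: degleM; exact: valP. Qed.

Definition polyleM t (p q : polyle t) : polyle (2 * t) :=
  exist _ (val p * val q) (degle_mul p q).

End BoundedDegree.

Arguments degle {n R}.
Arguments polyle1 {n R}.

Section MomentOperator.
Variables (n : nat) (R : fieldType) (t : nat).

Notation dual k := ('Hom(polyle n R k, R^o)).

Definition moment_op (L : dual (2 * t)) : 'Hom(polyle n R t, dual t) :=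
  linfun (fun p : polyle n R t =>
    linfun (fun q : polyle n R t => L (polyleM p q)) : dual t).

(* linfun is only meaningful on functions that are indeed linear. *)
Lemma moment_opE (L : dual (2 * t)) p q : moment_op L p q = L (polyleM p q).
Proof.
have linr u : linear (fun v : polyle n R t => L (polyleM u v) : R^o).
  move=> c v w; rewrite -linearP; congr (L _); apply: val_inj => /=.
  by rewrite mulrDr -scalerAr.
have innerE u v : (linfun (fun v : polyle n R t => L (polyleM u v)) : dual t) v
    = L (polyleM u v).
  pose h := HB.pack_for {linear polyle n R t -> R^o}
    (fun v : polyle n R t => L (polyleM u v) : R^o)
    (GRing.isLinear.Build _ _ _ _ _ (linr u)).
  by rewrite -[RHS]/(h v) -(lfunE h).
have linl : linear (fun u : polyle n R t =>
    linfun (fun v : polyle n R t => L (polyleM u v)) : dual t).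
  move=> c u w; apply/lfunP => v; rewrite add_lfunE scale_lfunE !innerE -linearP.
  by congr (L _); apply: val_inj => /=; rewrite mulrDl -scalerAl.
pose h := HB.pack_for {linear polyle n R t -> dual t}
    (fun u : polyle n R t =>
       linfun (fun v : polyle n R t => L (polyleM u v)) : dual t)
    (GRing.isLinear.Build _ _ _ _ _ linl).
by rewrite -[moment_op L]/(linfun h) lfunE /= innerE.
Qed.

Definition moment_rank (L : dual (2 * t)) : nat := \dim (limg (moment_op L)).

Definition moment_ker (L : dual (2 * t)) : set {mpoly R[n]} :=
  [set p | exists2 u : polyle n R t, u \in lker (moment_op L) & val u = p].

End MomentOperator.

Section Definitions.
Variables (n : nat) (R : realType).
Implicit Types (p q : {mpoly R[n]}) (B : set {mpoly R[n]}).

Definition ideal_gen B : set {mpoly R[n]} :=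
  [set p | exists (r : nat) (b a : 'I_r -> {mpoly R[n]}),
     (forall i, B (b i)) /\ p = \sum_(i < r) a i * b i].

Definition vanishing_ideal (X : set ('I_n -> R)) : set {mpoly R[n]} :=
  [set p | forall x, X x -> p.@[x] = 0].

Definition sos : set {mpoly R[n]} :=
  [set p | exists s : seq {mpoly R[n]}, p = \sum_(q <- s) q ^+ 2].

Definition sosle (k : int) : set {mpoly R[n]} :=
  [set p | exists2 s : seq {mpoly R[n]},
     {subset s <= degle k} & p = \sum_(q <- s) q ^+ 2].

Section Constraints.
Variables (n1 n2 : nat).
Variables (g0 : 'I_n1 -> {mpoly R[n]}) (gp : 'I_n2 -> {mpoly R[n]}).

Definition semialg : set ('I_n -> R) :=
  [set x | (forall i, (g0 i).@[x] = 0) /\ (forall j, 0 <= (gp j).@[x])].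

Definition gprod (e : {ffun 'I_n2 -> bool}) : {mpoly R[n]} :=
  \prod_(j < n2) gp j ^+ e j.

Definition preordering : set {mpoly R[n]} :=
  [set p | exists2 s : {ffun 'I_n2 -> bool} -> {mpoly R[n]},
     forall e, sos (s e) & p = \sum_e gprod e * s e].

Definition gradical : set {mpoly R[n]} :=
  [set p | exists (m : nat) (q : {mpoly R[n]}),
     [/\ (0 < m)%N, preordering q & ideal_gen (range g0) (p ^+ (2 * m) + q)]].

(* The differences are taken in int, hence may be negative. *)
Definition trunc_preordering (t : nat) : set {mpoly R[n]} :=
  [set p | exists (h : 'I_n1 -> {mpoly R[n]})
                  (s : {ffun 'I_n2 -> bool} -> {mpoly R[n]}),
     [/\ forall i, h i \in degle ((2 * t)%N%:Z - (mpdeg (g0 i))%:Z),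
         forall e, sosle (t%:Z - (uphalf (mpdeg (gprod e)))%:Z) (s e)
       & p = \sum_i g0 i * h i + \sum_e gprod e * s e]].

Lemma trunc_preordering_degle t p :
  trunc_preordering t p -> p \in degle (2 * t)%N.
Proof.
move=> [h [s [hh hs ->]]].
have degT q : q \in degle (mpdeg q) by rewrite degle_mpdeg lexx orbT.
apply: rpredD; apply: rpred_sum => i _.
  by have := degleM (degT (g0 i)) (hh i); rewrite addrC subrK.
have [r rs ->] := hs i; rewrite mulr_sumr big_seq; apply: rpred_sum => q /rs qr.
rewrite expr2; have /degleP H := degleM (degT (gprod i)) (degleM qr qr).
apply/degleP => m /H /le_trans; apply; lia.
Qed.

(* By trunc_preordering_degle, restricting to p : polyle _ _ (2 * t) loses no
   element of the truncated preordering. *)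
Definition moment_cone (t : nat) : set 'Hom(polyle n R (2 * t), R^o) :=
  [set L | (forall p : polyle n R (2 * t),
              trunc_preordering t (val p) -> (0 : R) <= L p)
           /\ L (polyle1 _) = 1].

Definition optimal_for_0 (t : nat) (L : 'Hom(polyle n R (2 * t), R^o)) : Prop :=
  moment_cone L /\
  forall L' : 'Hom(polyle n R (2 * t), R^o), moment_cone L' ->
    (moment_rank L' <= moment_rank L)%N.

End Constraints.
End Definitions.

(* Main.v *)
Require Import Defs.
From HB Require Import structures.
From mathcomp Require Import all_boot all_order all_algebra.
From mathcomp Require Import boolp classical_sets reals.
From mathcomp Require Import mpoly closed_field polyrcf qe_rcf_th ring zify.

(** The theorem combines the real Nullstellensatz with two facts about moment
matrices. Write S for the basic closed set and I(S) for its vanishing ideal.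

The kernel of an optimal form L vanishes on S: if x is in S, the midpoint of L
and of the evaluation at x satisfies the same positivity conditions, and the
kernel of its moment operator is the intersection of both kernels; as the rank
at L is maximal, this intersection is the whole kernel of L
([optimal_lker_sub]). Conversely every f in I(S) lies in the g-radical, so that
f ^ (2m) + q = 0 modulo the equations, with q in the preordering. As soon as t
exceeds the degrees in this identity, every L nonnegative on the truncated
preordering has L (f ^ (2m)) = 0, and positivity lowers the exponent step by
step until f itself is in the kernel ([moment_ker_root]). The threshold depends
on f, but I(S) is finitely generated ([hilbert_basis]), so one threshold serves
for a system of generators.

The real Nullstellensatz I(S) = g-radical is proved by Artin's method. If p
is not in the radical, a preordering maximal among those avoiding the opposites
of all p ^ (2m) is total with prime support, and yields a ring morphism to an
ordered field at which the constraints hold and p does not vanish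
([ordered_field_point]). It remains to replace the ordered field by the reals.

- The coefficients are first taken in a countable ring B with a morphism to the
reals, so the ordered field is countable. It then has an algebraic closure, in
which a maximal ordered subfield is real closed ([countable_real_closure]); this
rests on the fact that a polynomial changing sign over an ordered field has
a root in an ordered extension ([sign_change_root]).

- Between real closed fields, sign conditions can be transferred
([sign_transfer]). By Sturm's theorem the number of roots of a polynomial
subject to sign conditions is computed by finitely many sign tests on the
coefficients. Such a computation is a decision tree ([sign_determined]), which
takes the same branches in two fields that agree on the signs of the tests, and
this allows the coordinates of a point to be transferred one at a time. *)

Set Implicit Arguments.
Unset Strict Implicit.
Unset Printing Implicit Defensive.

Import Order.TTheory GRing.Theory Num.Theory.
Import Pdiv.Ring Pdiv.ComRing.

Local Open Scope classical_set_scope.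
Local Open Scope ring_scope.

(** * Ordered fields from cones *)

(** Zorn's lemma above a given set, where only nonempty chains need an upper
bound: this lets goodness include conditions such as containing 1. *)
Lemma Zorn_above (T : Type) (good : set (set T)) (A0 : set T) :
    good A0 ->
    (forall F : set (set T), F !=set0 -> F `<=` good -> total_on F subset ->
       good (\bigcup_(X in F) X)) ->
  exists A, [/\ A0 `<=` A, good A & forall B, good B -> A `<=` B -> B `<=` A].
Proof.
move=> gA0 chain.
(* Adding A0 to every set makes the empty chain harmless. *)
pose P : set (set T) := fun X => good (A0 `|` X).
have [|A [PA maxA]] := @Zorn_bigcup T P.
  move=> F FP totF; rewrite /P.
  have [F0|F0] := pselect (F = set0).
    by rewrite F0 bigcup_set0 setU0.
  have -> : A0 `|` \bigcup_(X in F) X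
      = \bigcup_(Y in [set A0 `|` X | X in F]) Y.
    rewrite eqEsubset; split=> x.
      move=> [A0x|[Y FY Yx]].
        by have [Y FY] := (set0P F).1 (introN eqP F0); exists (A0 `|` Y); [exists Y|left].
      by exists (A0 `|` Y) => //; [exists Y|right].
    by move=> [_ [Y FY <-]] [A0x|Yx]; [left|right; exists Y].
  apply: chain.
  - have [Y FY] : F !=set0 by apply/set0P/eqP.
    by exists (A0 `|` Y); exists Y.
  - by move=> _ [Y FY <-]; exact: FP.
  - move=> _ _ [Y FY <-] [Z FZ <-].
    by have [h|h] := totF _ _ FY FZ; [left|right] => x [?|/h ?]; [left|right|left|right].
exists (A0 `|` A); split => //.
move=> B gB sAB x Bx; apply: contrapT => nx.
apply: (maxA B).
  by split=> [y Ay|]; [apply: sAB; right|move=> /(_ x Bx) Ax; apply: nx; right].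
rewrite /P; suff -> : A0 `|` B = B by [].
by rewrite eqEsubset; split=> y; [move=> [?|//]; apply: sAB; left|right].
Qed.

(** The nonnegative elements of an ordering on some subfield of C, without fixing
the subfield in advance: the last condition says that the differences of
elements of P are again comparable with 0, so the subfield is the union of P
and - P. All the conditions are inherited by unions of chains. *)
Record field_cone (C : fieldType) (P : set C) : Prop := FieldCone {
  cone1 : P 1;
  coneD : forall x y, P x -> P y -> P (x + y);
  coneM : forall x y, P x -> P y -> P (x * y);
  coneV : forall x, P x -> P x^-1;
  cone_proper : forall x, P x -> P (- x) -> x = 0;
  coneB_total : forall x y, P x -> P y -> P (x - y) \/ P (y - x) }.

Section ConeField.
Variables (C : fieldType) (P : set C) (coneP : field_cone P).

Let P0 : P 0.
Proof.
by have [] := coneB_total coneP (cone1 coneP) (cone1 coneP); rewrite subrr.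
Qed.

(** The proof that P is a cone is an argument, so that the ordered field structure
below can be found from the type alone. *)
Definition cone_field_pred (_ : field_cone P) : {pred C} :=
  fun x => `[< P x \/ P (- x) >].

Lemma cone_field_divring : divring_closed (cone_field_pred coneP).
Proof.
split.
- by apply/asboolP; left; exact: cone1.
- move=> x y /asboolP hx /asboolP hy; apply/asboolP; rewrite opprB.
  case: hx hy => hx [] hy.
  + exact: coneB_total.
  + by left; apply: coneD.
  + by right; apply: coneD.
  + have := coneB_total coneP hx hy; rewrite !opprK.
    by rewrite [- x + y]addrC [- y + x]addrC => -[]; [right|left].
- move=> x y /asboolP hx /asboolP hy; apply/asboolP.
  have hy' : P y^-1 \/ P (- y^-1).
    by case: hy => hy; [left|right]; rewrite -?invrN; apply: coneV.
  case: hx hy' => hx [] hy'.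
  + by left; apply: coneM.
  + by right; rewrite -mulrN; apply: coneM.
  + by right; rewrite -mulNr; apply: coneM.
  + by left; rewrite -mulrNN; apply: coneM.
Qed.

HB.instance Definition _ :=
  GRing.isDivringClosed.Build C (cone_field_pred coneP) cone_field_divring.

Definition cone_field := {x : C | x \in cone_field_pred coneP}.

HB.instance Definition _ := SubChoice.on cone_field.
HB.instance Definition _ :=
  [SubChoice_isSubIntegralDomain of cone_field by <:].
HB.instance Definition _ := [SubIntegralDomain_isSubField of cone_field by <:].

Implicit Types x y : cone_field.
Let cle x y := `[< P (val y - val x) >].
Let clt x y := (y != x) && cle x y.
Let cnorm x := if cle 0 x then x else - x.

Let cle0E x : cle 0 x = `[< P (val x) >].
Proof. by rewrite /cle rmorph0 subr0. Qed.

Let cge0E x : cle x 0 = `[< P (- val x) >].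
Proof. by rewrite /cle rmorph0 sub0r. Qed.

Let cle0_add x y : cle 0 x -> cle 0 y -> cle 0 (x + y).
Proof.
rewrite !cle0E => /asboolP hx /asboolP hy; apply/asboolP.
by rewrite rmorphD; apply: coneD.
Qed.

Let cle0_mul x y : cle 0 x -> cle 0 y -> cle 0 (x * y).
Proof.
rewrite !cle0E => /asboolP hx /asboolP hy; apply/asboolP.
by rewrite rmorphM; apply: coneM.
Qed.

Let cle0_anti x : cle 0 x -> cle x 0 -> x = 0.
Proof.
rewrite cle0E cge0E => /asboolP hx /asboolP hy; apply: val_inj.
by rewrite rmorph0; apply: (cone_proper coneP).
Qed.

Let csub_ge0 x y : cle 0 (y - x) = cle x y.
Proof. by rewrite cle0E rmorphB. Qed.

Let cle0_total x : cle 0 x || cle x 0.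
Proof.
rewrite cle0E cge0E; have /asboolP[h|h] := valP x; apply/orP; [left|right];
  exact/asboolP.
Qed.

Let cnormN x : cnorm (- x) = cnorm x.
Proof.
rewrite /cnorm !cle0E rmorphN opprK.
have [h1|h1] := asboolP; have [h2|h2] := asboolP; rewrite ?opprK //.
  have -> : x = 0.
    by apply: cle0_anti; rewrite ?cle0E ?cge0E; apply/asboolP.
  by rewrite oppr0.
by have /asboolP[] := valP x.
Qed.

Let cge0_norm x : cle 0 x -> cnorm x = x.
Proof. by rewrite /cnorm => ->. Qed.

HB.instance Definition _ := Num.IntegralDomain_isLeReal.Build cone_field
  cle0_add cle0_mul cle0_anti csub_ge0 cle0_total cnormN cge0_norm
  (fun _ _ => erefl).

Lemma cone_field_ge0 x : (0 <= x) = `[< P (val x) >].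
Proof. exact: cle0E. Qed.

End ConeField.

Lemma ordered_field_of_cone (C : fieldType) (P : set C) : field_cone P ->
  exists (K : realFieldType) (j : {rmorphism K -> C}),
    (forall x, 0 <= x <-> P (j x)) /\
    (forall z, P z -> exists x, j x = z).
Proof.
move=> coneP; exists (cone_field coneP), (val : cone_field coneP -> C).
split=> [x|z Pz]; first by rewrite cone_field_ge0; split=> /asboolP.
have zP : z \in cone_field_pred coneP by apply/asboolP; left.
by exists (exist _ z zP).
Qed.

Lemma fraction_num_den (D : idomainType) (z : {fraction D}) :
  exists n d : D,
    d != 0 /\ z = FracField.tofrac n / FracField.tofrac d.
Proof.
elim/quotW: z => x; exists \n_x, \d_x; split; first exact: denom_ratioP.
have dx0 : FracField.tofrac (\d_x) != 0 by rewrite tofrac_eq0 denom_ratioP.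
apply: (mulIf dx0); rewrite divfK //; unlock FracField.tofrac.
rewrite !piE; apply/eqmodP; rewrite /= FracField.equivfE /FracField.mulf.
by rewrite !numden_Ratio ?mulf_neq0 ?oner_neq0 ?denom_ratioP // !mulr1 mulrC.
Qed.

Record prime_ideal (A : comNzRingType) (J : set A) : Prop := PrimeIdeal {
  primeD : forall x y, J x -> J y -> J (x + y);
  prime_absorb : forall a x, J x -> J (a * x);
  prime_proper : ~ J 1;
  prime_mul : forall x y, J (x * y) -> J x \/ J y }.

(** The residue field of a prime ideal is the fraction field of the quotient.
The quotient is given its units by choice, since only the ring structure of A
is available. *)
Lemma residue_field (A : comNzRingType) (J : set A) : prime_ideal J -> J 0 ->
  exists (F : fieldType) (f : {rmorphism A -> F}),
    (forall a, f a = 0 <-> J a) /\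
    (forall z, exists a b, f b != 0 /\ z = f a / f b).
Proof.
move=> Jp J0.
pose I : A -> bool := fun x => `[< J x >].
have Iid : idealr_closed I.
  split; [exact/asboolP|apply/asboolP; exact: prime_proper|].
  move=> a x y /asboolP Jx /asboolP Jy; apply/asboolP.
  by apply: (primeD Jp) => //; apply: (prime_absorb Jp).
pose IaM := GRing.isZmodClosed.Build _ I (idealr_closedB Iid).
pose IpM := isProperIdeal.Build _ I (idealr_closed_nontrivial Iid).
pose Ir : idealr A := HB.pack I IaM IpM.
pose Q : comNzRingType := {ideal_quot Ir}.
pose p : {rmorphism A -> Q} := \pi_Q%qT.
have p0 a : p a = 0 <-> J a.
  rewrite -(rmorph0 p); split=> [/eqP|Ja].
    by rewrite -Quotient.idealrBE subr0 => /asboolP.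
  by apply/eqP; rewrite -Quotient.idealrBE subr0; apply/asboolP.
have psurj z : exists a, p a = z by exists (repr z); exact: reprK.
pose unit : {pred Q} := fun x => `[< exists y, y * x = 1 >].
pose inv (x : Q) := if pselect (exists y, y * x = 1) is left h
                    then projT1 (cid h) else x.
have mulVx : {in unit, left_inverse 1 inv *%R}.
  move=> x /asboolP ux; rewrite /inv; case: pselect => // h.
  by case: (cid h).
have unitPl x y : y * x = 1 -> unit x by move=> yx; apply/asboolP; exists y.
have inv_out : {in [predC unit], inv =1 id}.
  by move=> x /asboolPn ux; rewrite /inv; case: pselect.
pose mU := GRing.ComNzRing_hasMulInverse.Build Q mulVx unitPl inv_out.
pose QU : comUnitRingType := HB.pack Q mU.
have Qint : GRing.integral_domain_axiom QU.
  move=> x y; have [a <-] := psurj x; have [b <-] := psurj y.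
  move=> /eqP; rewrite -rmorphM => /eqP/p0/(prime_mul Jp)[]/p0 -> .
    by rewrite eqxx.
  by rewrite eqxx orbT.
pose mI := GRing.ComUnitRing_isIntegral.Build QU Qint.
pose QI : idomainType := HB.pack Q mU mI.
pose pI : {rmorphism A -> QI} := p.
pose F : fieldType := {fraction QI}.
pose f : {rmorphism A -> F} := (@FracField.tofrac QI) \o pI.
have fE c : f c = FracField.tofrac (pI c) by [].
have f0 a : f a = 0 <-> J a.
  rewrite -p0 fE; split=> [/eqP|/eqP h]; first by rewrite tofrac_eq0 => /eqP.
  by apply/eqP; rewrite tofrac_eq0.
exists F, f; split=> // z.
have [n [d [d0 ->]]] := fraction_num_den z.
have [a an] := psurj n; have [b bd] := psurj d; exists a, b.
by rewrite !fE [pI a]an [pI b]bd tofrac_eq0.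
Qed.

(** * Preorderings and points in ordered fields *)

Lemma rmorphism_lift (A : pzRingType) (K F : fieldType)
    (j : {rmorphism K -> F}) (f : {rmorphism A -> F}) :
    (forall a, exists x, j x = f a) ->
  exists g : {rmorphism A -> K}, forall a, j (g a) = f a.
Proof.
move=> /choice[g jg].
have j_inj := fmorph_inj j.
have gB : zmod_morphism g by move=> x y; apply: j_inj; rewrite rmorphB !jg rmorphB.
have gM : monoid_morphism g.
  by split=> [|x y]; apply: j_inj; rewrite ?rmorph1 ?rmorphM !jg ?rmorph1 ?rmorphM.
pose mB := GRing.isZmodMorphism.Build _ _ g gB.
pose mM := GRing.isMonoidMorphism.Build _ _ g gM.
pose gr : {rmorphism A -> K} := HB.pack g mB mM.
by exists gr.
Qed.

Record preorder_cone (A : comNzRingType) (T : set A) : Prop := PreorderCone {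
  preorder_sqr : forall x, T (x ^+ 2);
  preorderD : forall x y, T x -> T y -> T (x + y);
  preorderM : forall x y, T x -> T y -> T (x * y) }.

Lemma preorder0 (A : comNzRingType) (T : set A) : preorder_cone T -> T 0.
Proof. by move=> Tc; rewrite -[0](mulr0 0) -expr2; exact: preorder_sqr. Qed.

Lemma preorder1 (A : comNzRingType) (T : set A) : preorder_cone T -> T 1.
Proof. by move=> Tc; rewrite -[1](mulr1 1) -expr2; exact: preorder_sqr. Qed.

(** T + a T is closed under products because a ^ 2 lies in T. *)
Lemma preorder_adjoin (A : comNzRingType) (T : set A) (a : A) :
  preorder_cone T ->
  preorder_cone [set z | exists x y, [/\ T x, T y & z = x + a * y]].
Proof.
move=> Tc; have T0 := preorder0 Tc; split.
- move=> x; exists (x ^+ 2), 0; rewrite mulr0 addr0; split=> //.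
  exact: (preorder_sqr Tc).
- move=> _ _ [x [y [Tx Ty ->]]] [x' [y' [Tx' Ty' ->]]].
  exists (x + x'), (y + y'); split; [exact: (preorderD Tc)..|ring].
- move=> _ _ [x [y [Tx Ty ->]]] [x' [y' [Tx' Ty' ->]]].
  exists (x * x' + a ^+ 2 * (y * y')), (x * y' + x' * y); split; last by ring.
    apply: (preorderD Tc); first exact: (preorderM Tc).
    by apply: (preorderM Tc); [exact: (preorder_sqr Tc)|exact: (preorderM Tc)].
  by apply: (preorderD Tc); apply: (preorderM Tc).
Qed.

Section PrimeCone.
Variables (A : comNzRingType) (T M : set A).
Hypotheses (Tc : preorder_cone T) (M1 : M 1).
Hypothesis (MM : forall s t, M s -> M t -> M (s * t)).
Hypotheses (MT : M `<=` T) (disjMT : forall s, M s -> ~ T (- s)).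

(** A preordering P maximal among those disjoint from - M is a prime cone. If a
is not in P then P + a P meets - M, so a y = - (s + x) with s in M and x, y in
P. Applied to a and - a, or to two factors of a product in the support, two
such identities multiply to put - (s s') in P, which is excluded. *)
Lemma maximal_preorder : exists P : set A,
  [/\ T `<=` P, preorder_cone P, forall s, M s -> ~ P (- s),
      forall a, P a \/ P (- a)
    & prime_ideal [set a | P a /\ P (- a)]].
Proof.
pose good (P : set A) := preorder_cone P /\ forall s, M s -> ~ P (- s).
have [//|F [X0 FX0] Fgood totF|P [TP [Pc disjP] maxP]] := @Zorn_above A good T.
  split; last by move=> s Ms [X FX]; apply: (Fgood X FX).2.
  have pair X Y x y : F X -> F Y -> X x -> Y y ->
      exists Z, [/\ F Z, Z x & Z y].
    by move=> FX FY Xx Yy; have [h|h] := totF _ _ FX FY;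
      [exists Y|exists X]; split => //; apply: h.
  split.
  - by move=> x; exists X0 => //; exact: (preorder_sqr (Fgood _ FX0).1).
  - move=> x y [X FX Xx] [Y FY Yy]; have [Z [FZ Zx Zy]] := pair _ _ _ _ FX FY Xx Yy.
    by exists Z => //; apply: (preorderD (Fgood _ FZ).1).
  - move=> x y [X FX Xx] [Y FY Yy]; have [Z [FZ Zx Zy]] := pair _ _ _ _ FX FY Xx Yy.
    by exists Z => //; apply: (preorderM (Fgood _ FZ).1).
have P0 := preorder0 Pc; have P1 := preorder1 Pc.
have hit a : ~ P a -> exists s x y, [/\ M s, P x, P y & a * y = - (s + x)].
  move=> nPa; apply: contrapT => nhit; apply: nPa.
  apply: (maxP _ (conj (preorder_adjoin a Pc) _)).
  - move=> s Ms [x [y [Px Py e]]]; apply: nhit; exists s, x, y; split => //.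
    by rewrite opprD e; ring.
  - by move=> x Px; exists x, 0; rewrite mulr0 addr0.
  - by exists 0, 1; rewrite mulr1 add0r.
have total a : P a \/ P (- a).
  apply: contrapT => /not_orP[/hit[s [x [y [Ms Px Py e]]]]
    /hit[s' [x' [y' [Ms' Px' Py' e']]]]].
  have TPM u : M u -> P u by move/MT/TP.
  apply: (disjP (s * s')); first exact: MM.
  have -> : - (s * s')
      = a ^+ 2 * (y * y') + (s * x' + (x * s' + x * x')).
    have : a ^+ 2 * (y * y') = - ((a * y) * (- a * y')) by ring.
    rewrite e e' => ->; ring.
  apply: (preorderD Pc).
    by apply: (preorderM Pc); [exact: (preorder_sqr Pc)|exact: (preorderM Pc)].
  by do ?apply: (preorderD Pc); apply: (preorderM Pc) => //; exact: TPM.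
exists P; split=> //; split=> /=.
- by move=> x y [h1 h2] [h3 h4]; rewrite opprD; split; apply: (preorderD Pc).
- move=> a x [h1 h2]; have [Pa|Pa] := total a.
    by rewrite -mulrN; split; apply: (preorderM Pc).
  by split; [rewrite -mulrNN|rewrite -mulNr]; apply: (preorderM Pc).
- by move=> [_]; exact: disjP.
- move=> a b [Pab Nab].
  apply: contrapT => /not_orP[nJa nJb].
  have oneside c : ~ (P c /\ P (- c)) -> exists s x y,
      [/\ M s, P x, P y & (c * y = s + x \/ c * y = - (s + x))].
    move=> /not_andP[|] /hit[s [x [y [Ms Px Py e]]]]; exists s, x, y; split=> //.
      by right.
    by left; apply: oppr_inj; rewrite -e mulNr.
  have [s [x [y [Ms Px Py e]]]] := oneside _ nJa.
  have [s' [x' [y' [Ms' Px' Py' e']]]] := oneside _ nJb.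
  have TPM u : M u -> P u by move/MT/TP.
  apply: (disjP (s * s')); first exact: MM.
  have hyy : P (a * b * (y * y')) /\ P (- (a * b * (y * y'))).
    by rewrite -mulNr; split; apply: (preorderM Pc) => //; apply: (preorderM Pc).
  have Pz : P (s * x' + (x * s' + x * x')).
    by do ?apply: (preorderD Pc); apply: (preorderM Pc) => //; exact: TPM.
  have abyy : a * b * (y * y') = (a * y) * (b * y') by ring.
  have hz : P (- ((s + x) * (s' + x'))).
    have [<-|<-] : a * b * (y * y') = (s + x) * (s' + x')
                \/ - (a * b * (y * y')) = (s + x) * (s' + x').
    + rewrite abyy; case: e => ->; case: e' => ->; [left|right|right|left]; ring.
    + by case: hyy.
    + by rewrite opprK; case: hyy.
  have -> : - (s * s') = - ((s + x) * (s' + x')) + (s * x' + (x * s' + x * x')).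
    by ring.
  exact: (preorderD Pc).
Qed.

(** An abstract Positivstellensatz: if T does not meet - M, some point of A with
values in an ordered field makes T nonnegative and M nonzero. The last clause
bounds the size of the field by that of A. *)
Theorem ordered_field_point :
  exists (K : realFieldType) (f : {rmorphism A -> K}),
    [/\ forall a, T a -> 0 <= f a,
        forall s, M s -> f s != 0
      & forall z, exists a b, f b != 0 /\ z = f a / f b].
Proof.
have [P [TP Pc disjP total Jp]] := maximal_preorder.
have P0 := preorder0 Pc; have P1 := preorder1 Pc.
have J0 : P 0 /\ P (- 0) by rewrite oppr0.
have [F [f [f0 fsurj]]] := residue_field Jp J0.
have nz c : f c != 0 -> ~ (P c /\ P (- c)).
  by move=> fc /f0 fc0; rewrite fc0 eqxx in fc.
(* Every fraction a / b can be written a b / b ^ 2, with the sign of a b. *)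
pose cone : set F := [set z | exists a b, [/\ P a, f b != 0 & z = f a / f b ^+ 2]].
have coneP : field_cone cone.
  split.
  - by exists 1, 1; rewrite rmorph1 expr1n divr1 oner_eq0.
  - move=> _ _ [a [b [Pa fb ->]]] [c [d [Pc' fd ->]]].
    exists (a * d ^+ 2 + c * b ^+ 2), (b * d); split.
    + by apply: (preorderD Pc); apply: (preorderM Pc) => //; exact: (preorder_sqr Pc).
    + by rewrite rmorphM mulf_neq0.
    + by rewrite !(rmorphM, rmorphD, rmorphXn) /=; field; rewrite fb fd.
  - move=> _ _ [a [b [Pa fb ->]]] [c [d [Pc' fd ->]]].
    exists (a * c), (b * d); split; first exact: (preorderM Pc).
      by rewrite rmorphM mulf_neq0.
    by rewrite !rmorphM /=; field; rewrite fb fd.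
  - move=> _ [a [b [Pa fb ->]]].
    have [fa|fa] := eqVneq (f a) 0.
      by exists 0, 1; rewrite fa mul0r invr0 rmorph0 mul0r rmorph1 oner_eq0.
    exists (a * b ^+ 2), a; split=> //.
      by apply: (preorderM Pc) => //; exact: (preorder_sqr Pc).
    by rewrite rmorphM rmorphXn /=; field; rewrite fa fb.
  - move=> _ [a [b [Pa fb ->]]] [c [d [Pc' fd e]]].
    have : f (a * d ^+ 2 + c * b ^+ 2) = 0.
      have := congr1 (fun u => - (u * (f b ^+ 2 * f d ^+ 2))) e.
      rewrite !(rmorphM, rmorphD, rmorphXn) /= => e'; apply/eqP.
      rewrite addr_eq0; apply/eqP; move: e'; rewrite !mulNr opprK.
      have -> : f a / f b ^+ 2 * (f b ^+ 2 * f d ^+ 2) = f a * f d ^+ 2.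
        by field; rewrite fb.
      by move=> ->; congr (- _); field; rewrite fd.
    move=> /f0 [_ N].
    have : f (a * d ^+ 2) = 0.
      apply/f0; split; first by apply: (preorderM Pc) => //; exact: (preorder_sqr Pc).
      have -> : - (a * d ^+ 2) = - (a * d ^+ 2 + c * b ^+ 2) + c * b ^+ 2 by ring.
      apply: (preorderD Pc) => //; apply: (preorderM Pc) => //.
      exact: (preorder_sqr Pc).
    rewrite rmorphM rmorphXn /= => /eqP; rewrite mulf_eq0 expf_eq0 (negPf fd).
    by rewrite andbF orbF => /eqP ->; rewrite mul0r.
  - move=> _ _ [a [b [Pa fb ->]]] [c [d [Pc' fd ->]]].
    have fbd : f (b * d) != 0 by rewrite rmorphM mulf_neq0.
    have [h|h] := total (a * d ^+ 2 - c * b ^+ 2); [left|right].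
      exists (a * d ^+ 2 - c * b ^+ 2), (b * d); split=> //.
      by rewrite !(rmorphM, rmorphB, rmorphXn) /=; field; rewrite fb fd.
    exists (- (a * d ^+ 2 - c * b ^+ 2)), (b * d); split=> //.
    by rewrite !(rmorphN, rmorphM, rmorphB, rmorphXn) /=; field; rewrite fb fd.
have [K [j [j_ge0 jsurj]]] := ordered_field_of_cone coneP.
have [z|g jg] := @rmorphism_lift A K F j f.
  have [h|h] := total z.
    by apply: jsurj; exists z, 1; rewrite rmorph1 expr1n divr1 oner_eq0.
  have [x jx] : exists x, j x = f (- z).
    by apply: jsurj; exists (- z), 1; rewrite rmorph1 expr1n divr1 oner_eq0.
  by exists (- x); rewrite rmorphN jx rmorphN opprK.
have geq0 a : (g a == 0) = (f a == 0) by rewrite -jg fmorph_eq0.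
exists K, g; split.
- move=> a /TP Pa; apply/j_ge0; rewrite jg.
  by exists a, 1; rewrite rmorph1 expr1n divr1 oner_eq0.
- move=> s Ms; rewrite geq0; apply/eqP => /f0[_]; exact: disjP.
- move=> z; have [a [b [fb e]]] := fsurj (j z); exists a, b; rewrite geq0; split=> //.
  by apply: (fmorph_inj j); rewrite fmorph_div !jg.
Qed.

End PrimeCone.

(** * Adjoining a root at a sign change *)

(** The weights are there because a nonnegative constant need not be a square
in K. *)
Inductive weighted_sos (K : realFieldType) : {poly K} -> Prop :=
| WeightedSos0 : weighted_sos 0
| WeightedSosCons k f w : 0 <= k -> weighted_sos w ->
    weighted_sos (k *: f ^+ 2 + w).

Section WeightedSos.
Variable K : realFieldType.
Implicit Types (f g h p q w : {poly K}) (a b k : K).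

Lemma weighted_sosD w w' :
  weighted_sos w -> weighted_sos w' -> weighted_sos (w + w').
Proof.
move=> hw hw'; elim: hw => [|k f {}w k0 _ IH]; first by rewrite add0r.
by rewrite -addrA; constructor.
Qed.

Lemma weighted_sosM w w' :
  weighted_sos w -> weighted_sos w' -> weighted_sos (w * w').
Proof.
move=> hw hw'; elim: hw => [|k f {}w k0 _ IH]; first by rewrite mul0r; constructor.
rewrite mulrDl; apply: weighted_sosD => //.
elim: hw' {IH} => [|k' f' v k0' _ IH']; first by rewrite mulr0; constructor.
rewrite mulrDr -scalerAl -scalerAr scalerA -exprMn.
by constructor => //; apply: mulr_ge0.
Qed.

Lemma weighted_sos_sqr f : weighted_sos (f ^+ 2).
Proof.
by rewrite -[f ^+ 2]addr0 -[f ^+ 2]scale1r; do !constructor.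
Qed.

Lemma weighted_sosZ k : 0 <= k -> weighted_sos k%:P.
Proof.
move=> k0; rewrite -[k%:P]addr0 -[k%:P]mulr1 mul_polyC -(expr1n _ 2).
by do !constructor.
Qed.

(** Each square (p d + r) ^ 2 is r ^ 2 plus a multiple of p, so modulo p the whole
sum has degree less than twice that of p. *)
Lemma weighted_sos_modp p w : p != 0 -> weighted_sos w ->
  exists w' h, [/\ weighted_sos w', (size w' <= ((size p).-1).*2.-1)%N
                 & w = w' + p * h].
Proof.
move=> p0; elim=> [|k f {}w k0 _ [w' [h [hw' sw' ->]]]].
  by exists 0, 0; rewrite size_poly0 mulr0 addr0; split=> //; constructor.
exists (k *: (f %% p) ^+ 2 + w'),
  (k *: ((f %/ p) * (f %/ p * p + (f %% p) *+ 2)) + h); split.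
- by constructor.
- rewrite (leq_trans (size_polyD _ _)) // geq_max sw' andbT.
  rewrite (leq_trans (size_scale_leq _ _)) // expr2.
  have : (size (f %% p)%R <= (size p).-1)%N.
    by have := ltn_modp f p; rewrite p0; case: (size p).
  rewrite -addnn => sr; apply: leq_trans (size_polyMleq _ _) _.
  by rewrite -!subn1 leq_sub2r // leq_add // subn1.
- rewrite {1}(divp_eq f p) -!mul_polyC; ring.
Qed.

Lemma weighted_sos_ge0 (L : realFieldType) (i : {rmorphism K -> L}) w (x : L) :
  {homo i : y / 0 <= y} -> weighted_sos w -> 0 <= (map_poly i w).[x].
Proof.
move=> i0; elim=> [|k f {}w k0 _ IH]; first by rewrite rmorph0 horner0.
rewrite rmorphD hornerD addr_ge0 //= map_polyZ rmorphXn hornerZ horner_exp.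
by rewrite mulr_ge0 ?sqr_ge0 ?i0.
Qed.

Lemma weighted_sos_ge0_self w x : weighted_sos w -> 0 <= w.[x].
Proof.
move=> hw; have := @weighted_sos_ge0 K idfun w x (fun y (h : 0 <= y) => h) hw.
by rewrite map_poly_id.
Qed.

(** The point of K[X] that is sought must kill p, so it is enough that - 1 is not
a weighted sum of squares modulo p. Otherwise 1 + w = p q with w a weighted sum
of squares of polynomials of degree less than that of p; the degree of q is
then less than that of p, and q changes sign as p does because p q is positive
everywhere. By induction q has a root x in an ordered extension, where
1 + w (x) = 0 is absurd. *)
Lemma sign_change_root p a b : p.[a] < 0 < p.[b] ->
  exists (L : realFieldType) (i : {rmorphism K -> L}) (x : L),
    {homo i : y / 0 <= y} /\ root (map_poly i p) x.
Proof.
elim: {p}_.+1 {-2}p (ltnSn (size p)) a b => // n IH p sp a b /andP[pa pb].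
have p0 : p != 0 by apply: contraTneq pb => ->; rewrite horner0 ltxx.
have sp1 : (1 < size p)%N.
  rewrite ltnNge; apply/negP => /size1_polyC e.
  by move: pa pb; rewrite e !hornerC => /lt_trans h /h; rewrite ltxx.
pose T : set {poly K} := [set q | exists w h, weighted_sos w /\ q = w + p * h].
have Tsos w : weighted_sos w -> T w by exists w, 0; rewrite mulr0 addr0.
have Tc : preorder_cone T.
  split.
  - by move=> f; exact/Tsos/weighted_sos_sqr.
  - move=> _ _ [w [h [hw ->]]] [w' [h' [hw' ->]]]; exists (w + w'), (h + h').
    by split; [exact: weighted_sosD|ring].
  - move=> _ _ [w [h [hw ->]]] [w' [h' [hw' ->]]].
    exists (w * w'), (w * h' + h * (w' + p * h')).
    by split; [exact: weighted_sosM|ring].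
have T1 : T 1 by apply: Tsos; rewrite -(expr1n _ 2); apply: weighted_sos_sqr.
have disj s : s = 1 -> ~ T (- s).
  move=> -> [w [h [hw e]]].
  have [w' [g [hw' sw' ew]]] := weighted_sos_modp p0 hw.
  pose q := - (h + g).
  have eq1 : 1 + w' = p * q.
    rewrite /q mulrN mulrDr -[w'](addrK (p * g)) -ew.
    have -> : 1 = - (w + p * h) by rewrite -e opprK.
    ring.
  have pos x : 0 < p.[x] * q.[x].
    rewrite -hornerM -eq1 hornerD hornerC ltr_pwDl //.
    exact: weighted_sos_ge0_self.
  have q0 : q != 0.
    by apply: contraTneq (pos a) => ->; rewrite horner0 mulr0 ltxx.
  have sq : (size q < n)%N.
    have : (size (p * q)%R <= ((size p).-1).*2.-1)%N.
      rewrite -eq1 (leq_trans (size_polyD _ _)) // geq_max sw' andbT size_poly1.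
      move: sp1; lia.
    rewrite size_mul //; move: sp sp1; move: (size p) (size q) => d d'; lia.
  have qab : q.[a] < 0 < q.[b].
    by move: (pos a) (pos b); rewrite nmulr_rgt0 // pmulr_rgt0 // => -> ->.
  have [L [i [x [i0 rx]]]] := IH _ sq _ _ qab.
  have := weighted_sos_ge0 x i0 hw'.
  have := congr1 (fun u => (map_poly i u).[x]) eq1.
  rewrite rmorphM rmorphD rmorph1 hornerD hornerC hornerM.
  move: rx; rewrite rootE => /eqP ->.
  by rewrite mulr0 => e1 h1; have := ltr_pwDl ltr01 h1; rewrite e1 ltxx.
have [//|s t -> ->|s ->|s|L [f [f0 _ _]]] := @ordered_field_point _ T [set 1] Tc.
- exact: mulr1.
- exact: T1.
- exact: disj.
pose i : {rmorphism K -> L} := f \o polyC.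
exists L, i, (f 'X); split=> [y y0|].
  exact/f0/Tsos/weighted_sosZ.
rewrite rootE (map_poly_comp f polyC) horner_map [_.['X]]comp_polyXr.
have [Tp TNp] : T p /\ T (- p).
  by split; exists 0; [exists 1|exists (-1)]; split; rewrite ?add0r ?mulr1 ?mulrN1 //;
    constructor.
by rewrite eq_le f0 // andbT -oppr_ge0 -rmorphN f0.
Qed.
End WeightedSos.

(** * Real closure of a countable ordered field *)

Section RealClosureInside.
Variables (C : closedFieldType) (P0 : set C).
Hypothesis P0cone : field_cone P0.

Lemma maximal_field_cone : exists P : set C,
  [/\ P0 `<=` P, field_cone P &
      forall Q, field_cone Q -> P `<=` Q -> Q `<=` P].
Proof.
apply: Zorn_above => // F [X0 FX0] Fcone totF.
have pair x y : (\bigcup_(X in F) X) x -> (\bigcup_(X in F) X) y ->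
    exists Z, [/\ F Z, Z x & Z y].
  move=> [X FX Xx] [Y FY Yy].
  by have [h|h] := totF _ _ FX FY; [exists Y|exists X]; split=> //; apply: h.
split.
- by exists X0 => //; apply: (cone1 (Fcone _ FX0)).
- move=> x y Ux Uy; have [Z [FZ Zx Zy]] := pair x y Ux Uy.
  by exists Z => //; apply: (coneD (Fcone _ FZ)).
- move=> x y Ux Uy; have [Z [FZ Zx Zy]] := pair x y Ux Uy.
  by exists Z => //; apply: (coneM (Fcone _ FZ)).
- by move=> x [Z FZ Zx]; exists Z => //; apply: (coneV (Fcone _ FZ)).
- move=> x Ux Uy; have [Z [FZ Zx Zy]] := pair x (- x) Ux Uy.
  exact: (cone_proper (Fcone _ FZ)).
- move=> x y Ux Uy; have [Z [FZ Zx Zy]] := pair x y Ux Uy.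
  by have [h|h] := coneB_total (Fcone _ FZ) Zx Zy; [left|right]; exists Z.
Qed.

(** Let p change sign over the ordered subfield K of C given by a maximal cone. If
p is reducible, one of its factors changes sign. If p is irreducible, it has
a root z in C and a root x in an ordered extension of K; K(z) and K(x) are
isomorphic over K, so the order of K(x) defines a cone Q on K(z), which
maximality forces to be the given one. Hence z is in K. *)
Lemma maximal_cone_root (P : set C) (K : realFieldType)
    (j : {rmorphism K -> C}) :
    (forall Q, field_cone Q -> P `<=` Q -> Q `<=` P) ->
    (forall x, 0 <= x <-> P (j x)) -> (forall z, P z -> exists x, j x = z) ->
  forall (p : {poly K}) a b, p.[a] * p.[b] < 0 -> exists x, root p x.
Proof.
move=> maxP jP jsurj p.
elim: {p}_.+1 {-2}p (ltnSn (size p)) => // n IH p sp a b pab.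
have [irr|nirr] := pselect (irreducible_poly p); last first.
  have sp1 : (1 < size p)%N.
    rewrite ltnNge; apply: contraTN pab => /size1_polyC ->.
    by rewrite !hornerC -leNgt -expr2 sqr_ge0.
  have [q /not_implyP[sq1 /not_implyP[qp nqp]]] :
      exists q : {poly K}, ~ (size q != 1%N -> q %| p -> q %= p).
    by apply/existsNP => h; apply: nirr.
  have p0 : p != 0 by rewrite -size_poly_eq0 -lt0n ltnW.
  have pE : p = (p %/ q) * q by rewrite divpK.
  have q0 : q != 0 by apply: contraNneq p0 => q0; rewrite pE q0 mulr0.
  have d0 : p %/ q != 0 by apply: contraNneq p0 => d0; rewrite pE d0 mul0r.
  have sE : (size p).+1 = (size (p %/ q)%R + size q)%N.
    by rewrite {1}pE size_mul // prednK // addn_gt0 lt0n size_poly_eq0 d0.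
  have sq : (size q < size p)%N.
    rewrite ltn_neqAle dvdp_leq // andbT; apply/eqP => e; apply: nqp.
    by rewrite -(dvdp_size_eqp qp) e eqxx.
  have sq2 : (1 < size q)%N.
    by rewrite ltn_neqAle eq_sym sq1 lt0n size_poly_eq0.
  have sd : (size (p %/ q)%R < size p)%N by move: sE sq2; lia.
  have : (p %/ q).[a] * (p %/ q).[b] < 0 \/ q.[a] * q.[b] < 0.
    have pab' : ((p %/ q).[a] * (p %/ q).[b]) * (q.[a] * q.[b]) < 0.
      by rewrite mulrACA -!hornerM -pE.
    have [h1|h1] := ltP ((p %/ q).[a] * (p %/ q).[b]) 0; first by left.
    have [h2|h2] := ltP (q.[a] * q.[b]) 0; first by right.
    by move: pab'; rewrite ltNge mulr_ge0.
  case=> h.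
    by have [x rx] := IH _ (leq_trans sd sp) _ _ h; exists x; rewrite pE rootM rx.
  by have [x rx] := IH _ (leq_trans sq sp) _ _ h; exists x; rewrite pE rootM rx orbT.
have [L [i [x [i0 rx]]]] : exists (L : realFieldType) (i : {rmorphism K -> L}) (x : L),
    {homo i : y / 0 <= y} /\ root (map_poly i p) x.
  have /orP[/andP[pa pb]|/andP[pa pb]] : (p.[a] < 0 < p.[b]) || (p.[b] < 0 < p.[a]).
    move: pab; case: (ltgtP p.[a] 0) => [pa|pa|->]; last by rewrite mul0r ltxx.
      by rewrite nmulr_rlt0 // => ->.
    by rewrite pmulr_rlt0 // => ->.
  - by apply: sign_change_root (_ : p.[a] < 0 < p.[b]); rewrite pa pb.
  - by apply: sign_change_root (_ : p.[b] < 0 < p.[a]); rewrite pa pb.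
have [z rz] : exists z, root (map_poly j p) z.
  by apply/closed_rootP; rewrite size_map_poly gtn_eqF //; case: irr.
have ndvd (E : fieldType) (h : {rmorphism K -> E}) e r :
    root (map_poly h p) e -> (map_poly h r).[e] != 0 -> exists u, forall
      (E' : fieldType) (h' : {rmorphism K -> E'}) e', root (map_poly h' p) e' ->
      (map_poly h' r).[e'] * (map_poly h' u).[e'] = 1.
  move=> re nre; have cop : coprimep p r.
    apply/coprimepP => d dp dr; rewrite -size_poly_eq1.
    apply: contraNT nre => sd; rewrite -rootE; apply: (root_dvdp _ re).
    by rewrite dvdp_map -(eqp_dvdl _ (irr.2 d sd dp)).
  have /Bezout_eq1_coprimepP[[v u] /= vu] := cop.
  exists u => E' h' e' re'.
  have := congr1 (fun s => (map_poly h' s).[e']) vu.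
  rewrite /= rmorphD !rmorphM rmorph1 hornerD !hornerM hornerC (rootP re') mulr0 add0r.
  by rewrite mulrC.
have ker (E E' : fieldType) (h : {rmorphism K -> E}) (h' : {rmorphism K -> E'}) e e' r :
    root (map_poly h p) e -> root (map_poly h' p) e' ->
    (map_poly h r).[e] = 0 -> (map_poly h' r).[e'] = 0.
  move=> re re' r0; apply/eqP/negPn/negP => /(ndvd _ _ _ _ re')[u /(_ _ h e re)].
  by rewrite r0 mul0r => /eqP; rewrite eq_sym oner_eq0.
pose Q : set C :=
  [set y | exists r, (map_poly j r).[z] = y /\ 0 <= (map_poly i r).[x]].
have Qcone : field_cone Q.
  split.
  - by exists 1; rewrite !rmorph1 !hornerC ler01.
  - move=> _ _ [r [<- r0]] [s [<- s0]]; exists (r + s).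
    by rewrite !rmorphD !hornerD addr_ge0.
  - move=> _ _ [r [<- r0]] [s [<- s0]]; exists (r * s).
    by rewrite !rmorphM !hornerM mulr_ge0.
  - move=> _ [r [<- r0]]; have [e|nz] := eqVneq (map_poly j r).[z] 0.
      by exists 0; rewrite e invr0 !rmorph0 !horner0.
    have [u ru] := ndvd _ _ _ _ rz nz; exists u.
    split; first by apply: (mulfI nz); rewrite ru // mulfV.
    have := ru _ _ _ rx; move=> e1.
    have : 0 < (map_poly i r).[x].
      rewrite lt_def r0 andbT; apply/eqP => e; move/eqP: e1.
      by rewrite e mul0r eq_sym oner_eq0.
    by move=> rp; rewrite -(pmulr_rge0 _ rp) e1 ler01.
  - move=> _ [r [<- r0]] [s [e s0]].
    have : (map_poly j (r + s)).[z] = 0 by rewrite rmorphD hornerD e subrr.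
    move=> /(ker _ _ _ _ _ _ _ rz rx); rewrite rmorphD hornerD => /eqP.
    rewrite paddr_eq0 // => /andP[/eqP h _]; exact: (ker _ _ _ _ _ _ _ rx rz).
  - move=> _ _ [r [<- r0]] [s [<- s0]].
    have [h|h] := leP (map_poly i r).[x] (map_poly i s).[x]; [right|left].
      by exists (s - r); rewrite !rmorphB !hornerD !hornerN subr_ge0.
    by exists (r - s); rewrite !rmorphB !hornerD !hornerN subr_ge0 ltW.
have PQ : P `<=` Q.
  move=> y Py; have [u ju] := jsurj y Py; exists u%:P.
  by rewrite !map_polyC !hornerC /= ju i0 //; apply/jP; rewrite ju.
have QP := maxP _ Qcone PQ.
have [y jy] : exists y, j y = z.
  have [x0|x0] := leP 0 x.
    have /QP/jsurj[y jy] : Q z by exists 'X; rewrite !map_polyX !hornerX.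
    by exists y.
  have /QP/jsurj[y jy] : Q (- z).
    by exists (- 'X); rewrite !rmorphN /= !map_polyX !hornerN !hornerX oppr_ge0 ltW.
  by exists (- y); rewrite rmorphN jy opprK.
by exists y; rewrite -(fmorph_root j) jy.
Qed.

(** A root that is not between a and b can be divided out without affecting the
change of sign on the interval. *)
Lemma ivt_of_sign_change_root (K : realFieldType) :
    (forall (p : {poly K}) a b, p.[a] * p.[b] < 0 -> exists x, root p x) ->
  Num.real_closed_axiom K.
Proof.
move=> sroot; suff ivt n (p : {poly K}) a b : (size p < n)%N -> a <= b ->
    p.[a] * p.[b] < 0 -> exists2 x, a <= x <= b & root p x.
  move=> p a b ab /andP[]; rewrite le_eqVlt => /orP[/eqP pa _|pa].
    by exists a; rewrite ?lexx // rootE pa.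
  rewrite le_eqVlt => /orP[/eqP pb|pb].
    by exists b; rewrite ?lexx ?ab // rootE -pb.
  by apply: (ivt _ p a b (ltnSn _)) => //; rewrite nmulr_rlt0.
elim: n p => // n IH p sp ab pab.
have [c rc] := sroot _ _ _ pab.
have [acb|nacb] := boolP (a <= c <= b); first by exists c.
have /factor_theorem[q pE] := rc.
have q0 : q != 0.
  by apply: contraTneq pab => q0; rewrite pE q0 mul0r horner0 mul0r ltxx.
have sq : (size q < n)%N.
  by move: sp; rewrite pE size_Mmonic ?monicXsubC // size_XsubC addn2.
have cc : 0 < (a - c) * (b - c).
  move: nacb; rewrite negb_and -!ltNge => /orP[h|h].
    by rewrite mulr_gt0 // subr_gt0 // (lt_le_trans h).
  by rewrite nmulr_rgt0 subr_lt0 // (le_lt_trans ab).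
suff [x xab rx] : exists2 x, a <= x <= b & root q x.
  by exists x; rewrite // pE rootM rx.
apply: IH => //; move: pab; rewrite pE !hornerM !hornerXsubC mulrACA.
by rewrite mulrC pmulr_rlt0.
Qed.

Theorem real_closed_inside : exists (M : rcfType) (j : {rmorphism M -> C}),
  forall z, P0 z -> exists2 x, 0 <= x & j x = z.
Proof.
have [P [P0P Pcone maxP]] := maximal_field_cone.
have [K [j [jP jsurj]]] := ordered_field_of_cone Pcone.
have closed := ivt_of_sign_change_root (maximal_cone_root maxP jP jsurj).
pose M : rcfType := HB.pack K (Num.RealField_isClosed.Build K closed).
exists M, j => z /P0P Pz; have [x jx] := jsurj z Pz; exists x => //.
by apply/jP; rewrite jx.
Qed.

End RealClosureInside.

(** Countability provides an algebraic closure in which to look for a maximal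
ordered subfield. *)
Theorem countable_real_closure (K : realFieldType) (code : K -> nat) :
    injective code ->
  exists (M : rcfType) (i : {rmorphism K -> M}), {homo i : y / 0 <= y}.
Proof.
move=> code_inj.
pose decode n := if pselect (exists x, code x = n) is left h
                 then Some (projT1 (cid h)) else None.
have codeK : pcancel code decode.
  move=> x; rewrite /decode; case: pselect => [h|[]]; last by exists x.
  by case: (cid h) => y /= /code_inj ->.
pose Kc : countFieldType := HB.pack K (isCountable.Build K codeK).
have [C [i _]] := countable_algebraic_closure Kc.
pose i' : {rmorphism K -> C} := i.
pose P : set C := [set z | exists2 x, 0 <= x & i' x = z].
have Pcone : field_cone P.
  split.
  - by exists 1; rewrite ?ler01 ?rmorph1.
  - move=> _ _ [x x0 <-] [y y0 <-].
    by exists (x + y); rewrite ?addr_ge0 ?rmorphD.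
  - move=> _ _ [x x0 <-] [y y0 <-].
    by exists (x * y); rewrite ?mulr_ge0 ?rmorphM.
  - by move=> _ [x x0 <-]; exists x^-1; rewrite ?invr_ge0 ?fmorphV.
  - move=> _ [x x0 <-] [y y0]; rewrite -rmorphN => /fmorph_inj e.
    suff -> : x = 0 by rewrite rmorph0.
    by apply/eqP; rewrite eq_le x0 andbT -oppr_ge0 -e.
  - move=> _ _ [x x0 <-] [y y0 <-]; have [h|h] := leP x y; [right|left].
      by exists (y - x); rewrite ?subr_ge0 ?rmorphB.
    by exists (x - y); rewrite ?subr_ge0 ?rmorphB // ltW.
have [M [j jP]] := real_closed_inside Pcone.
have jex x : 0 <= x -> exists2 y, 0 <= y & j y = i' x.
  by move=> x0; apply: jP; exists x.
have [x|g jg] := @rmorphism_lift K M C j i'.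
  have [/jex[y _ jy]|x0] := leP 0 x; first by exists y.
  have [|y _ jy] := jex (- x); first by rewrite oppr_ge0 ltW.
  by exists (- y); rewrite rmorphN jy rmorphN opprK.
exists M, g => x /jex[y y0 jy].
by have <- : y = g x by apply: (fmorph_inj j); rewrite jy jg.
Qed.

(** * Computations by sign tests *)

(** A computation whose only access to B is to ask for the sign of an element. *)
Inductive sign_tree (B X : Type) : Type :=
| Leaf of X
| SignTest of B & sign_tree B X & sign_tree B X & sign_tree B X.
Arguments Leaf {B X}.

Fixpoint run_tree (B X : Type) (F : realDomainType) (phi : B -> F)
    (t : sign_tree B X) : X :=
  match t with
  | Leaf x => x
  | SignTest b neg zero pos =>
      if phi b == 0 then run_tree phi zero
      else if phi b < 0 then run_tree phi neg else run_tree phi pos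
  end.

Fixpoint tree_tests (B X : Type) (t : sign_tree B X) : seq B :=
  match t with
  | Leaf _ => [::]
  | SignTest b neg zero pos =>
      b :: tree_tests neg ++ tree_tests zero ++ tree_tests pos
  end.

Fixpoint graft (B X Y : Type) (t : sign_tree B X) (k : X -> sign_tree B Y) :=
  match t with
  | Leaf x => k x
  | SignTest b neg zero pos =>
      SignTest b (graft neg k) (graft zero k) (graft pos k)
  end.

Lemma run_graft (B X Y : Type) (F : realDomainType) (phi : B -> F)
    (t : sign_tree B X) (k : X -> sign_tree B Y) :
  run_tree phi (graft t k) = run_tree phi (k (run_tree phi t)).
Proof. by elim: t => //= b tn -> tz -> tp ->; case: ifP => // _; case: ifP. Qed.

(** This is the reason for the trees: two fields in which the tests have the same
signs cannot be told apart by the computation. *)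
Lemma run_tree_agree (B : eqType) (X : Type) (F F' : realDomainType)
    (phi : B -> F) (phi' : B -> F') (t : sign_tree B X) :
    {in tree_tests t, forall b, sgz (phi b) = sgz (phi' b)} ->
  run_tree phi t = run_tree phi' t.
Proof.
elim: t => //= b tn IHn tz IHz tp IHp agree.
have sub t : {subset t <= tree_tests tn ++ tree_tests tz ++ tree_tests tp} ->
    {in t, forall b, sgz (phi b) = sgz (phi' b)}.
  by move=> tsub c ct; apply: agree; rewrite inE tsub ?orbT.
have bb := agree b (mem_head _ _).
rewrite -sgz_eq0 -[phi b < 0]sgz_lt0 bb sgz_eq0 sgz_lt0.
case: ifP => _; [apply: IHz|case: ifP => _; [apply: IHn|apply: IHp]];
  by apply: sub => c ct; rewrite !mem_cat ct ?orbT.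
Qed.

Section SignDetermined.
Variable B : comNzRingType.
Implicit Types (p q : {poly B}).

(** A discrete quantity attached to each morphism from B to a real closed field,
to be thought of as a specialization of the parameters in B. *)
Definition evaluation X := forall F : rcfType, {rmorphism B -> F} -> X.

Definition sign_determined X (h : evaluation X) : Prop :=
  exists t : sign_tree B X, forall (F : rcfType) (phi : {rmorphism B -> F}),
    run_tree phi t = h F phi.

Lemma sign_determined_ext X (h h' : evaluation X) :
    (forall (F : rcfType) (phi : {rmorphism B -> F}), h F phi = h' F phi) ->
  sign_determined h -> sign_determined h'.
Proof. by move=> hh' [t ht]; exists t => F phi; rewrite ht hh'. Qed.

Lemma sign_determined_const X (x : X) : sign_determined (fun F _ => x).
Proof. by exists (Leaf x). Qed.

Lemma sign_determined_bind X Y (h : evaluation X) (k : X -> evaluation Y) :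
    sign_determined h -> (forall x, sign_determined (k x)) ->
  sign_determined (fun F phi => k (h F phi) F phi).
Proof.
move=> [t ht] /choice[u hu]; exists (graft t u) => F phi.
by rewrite run_graft ht hu.
Qed.

Lemma sign_determined_map X Y (f : X -> Y) (h : evaluation X) :
  sign_determined h -> sign_determined (fun F phi => f (h F phi)).
Proof.
move=> hh; apply: (sign_determined_bind (k := fun x _ _ => f x) hh) => x.
exact: sign_determined_const.
Qed.

Lemma sign_determined_map2 X Y Z (f : X -> Y -> Z) h h' :
  sign_determined h -> sign_determined h' ->
  sign_determined (fun F phi => f (h F phi) (h' F phi)).
Proof.
move=> hh hh'.
by apply: (sign_determined_bind (k := fun x F phi => f x (h' F phi)) hh) => x;
  apply: sign_determined_map.
Qed.

Lemma sign_determined_big X (idx : X) (op : X -> X -> X) I (r : seq I)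
    (h : I -> evaluation X) :
  (forall i, sign_determined (h i)) ->
  sign_determined (fun F phi => \big[op/idx]_(i <- r) h i F phi).
Proof.
move=> hh; elim: r => [|i r IH].
  by apply: sign_determined_ext (sign_determined_const idx) => F phi; rewrite big_nil.
apply: sign_determined_ext (sign_determined_map2 op (hh i) IH) => F phi.
by rewrite big_cons.
Qed.

Lemma sign_determined_sgz b : sign_determined (fun F phi => sgz (phi b)).
Proof.
exists (SignTest b (Leaf (-1)) (Leaf 0) (Leaf 1)) => F phi /=.
by case: sgzP.
Qed.

Lemma map_take_poly (F : nzRingType) (phi : {rmorphism B -> F}) p :
  phi (lead_coef p) = 0 ->
  map_poly phi p = map_poly phi (take_poly (size p).-1 p).
Proof.
move=> lp0; apply/polyP => i; rewrite !coef_map coef_take_poly.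
case: ifP => // /negbT; rewrite -leqNgt leq_eqVlt => /orP[/eqP <-|h].
  exact: etrans lp0 (esym (rmorph0 phi)).
by rewrite nth_default //; case: (size p) h.
Qed.

(** The leading coefficient may vanish after specialization: testing it decides
whether to keep it or to continue with the truncated polynomial. *)
Lemma sign_determined_lead p : sign_determined (fun F phi =>
  (size (map_poly phi p), sgz (lead_coef (map_poly phi p)))).
Proof.
elim: {p}_.+1 {-2}p (ltnSn (size p)) => // n IH p sp.
have [->|p0] := eqVneq p 0.
  apply: sign_determined_ext (sign_determined_const (0%N, 0%Z)) => F phi.
  by rewrite map_poly0 size_poly0 lead_coef0 sgz0.
pose p' := take_poly (size p).-1 p.
have sp' : (size p' < n)%N.
  apply: leq_ltn_trans (size_take_poly _ _) _.
  by move: sp p0; rewrite -size_poly_eq0; case: (size p).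
pose k (s : int) : evaluation (nat * int) := fun F phi =>
  if s == 0 then (size (map_poly phi p'), sgz (lead_coef (map_poly phi p')))
  else (size p, s).
have hk s : sign_determined (k s).
  by rewrite /k; case: (s == 0); [exact: IH|exact: sign_determined_const].
apply: sign_determined_ext (sign_determined_bind (sign_determined_sgz (lead_coef p)) hk).
move=> F phi; rewrite /k sgz_eq0; have [l0|l0] := eqVneq (phi (lead_coef p)) 0.
  by rewrite [in RHS]map_take_poly.
by rewrite lead_coef_map_eq // size_map_poly_id0.
Qed.

Lemma crossRE (F : rcfType) (p : {poly F}) :
  crossR p = sgz (lead_coef p) * (odd (size p).-1)%:R.
Proof.
rewrite /crossR /variation /sgp_pinfty /sgp_minfty sgz_sgr.
have [->|l0] := eqVneq (lead_coef p) 0; first by rewrite sgz0 !mul0r.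
congr (_ * _); rewrite -signr_odd; case: odd; rewrite ?expr1 ?expr0 ?mulN1r ?mul1r.
  rewrite sgrN mulNr oppr_lt0 -sgrM sgr_gt0.
  by rewrite -expr2 exprn_even_gt0 //= l0.
by rewrite -sgrM sgr_lt0 -expr2 ltNge sqr_ge0.
Qed.

Lemma sign_determined_crossR p :
  sign_determined (fun F phi => crossR (map_poly phi p)).
Proof.
apply: sign_determined_ext (sign_determined_map
  (fun u => u.2 * (odd u.1.-1)%:R) (sign_determined_lead p)) => F phi /=.
by rewrite crossRE.
Qed.

Lemma changes_modsZ (F : rcfType) (c : F) (p q : {poly F}) :
  changes_mods p (c *: q) = sgz c * changes_mods p q.
Proof.
rewrite !changes_mods_cindex /cindexR mulr_sumr.
by apply: eq_bigr => x _; rewrite jump_mulCp.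
Qed.

(** Pseudo-division does not commute with specialization, as the number of steps
may differ, but both remainders are remainders of multiples of the same
polynomial by the same divisor. They differ by a quotient of powers of the
leading coefficient of the divisor, which enters squared. *)
Lemma next_mod_map (F : rcfType) (phi : {rmorphism B -> F}) p q :
    q != 0 -> phi (lead_coef q) != 0 ->
  exists c : F, 0 < c /\ next_mod (map_poly phi p) (map_poly phi q) =
    c *: map_poly phi (- (lead_coef q ^+ rscalp p q) *: rmodp p q).
Proof.
move=> q0 lq.
set P := map_poly phi p; set Q := map_poly phi q; set l := phi (lead_coef q).
have lQ : lead_coef Q = l by rewrite lead_coef_map_eq.
have Q0 : Q != 0 by rewrite -lead_coef_eq0 lQ.
have sQ : size Q = size q by rewrite size_map_poly_id0.
pose s := rscalp p q; pose s' := rscalp P Q.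
have e1 : l ^+ s *: P = map_poly phi (rdivp p q) * Q + map_poly phi (rmodp p q).
  have := congr1 (map_poly phi) (rdivp_eq q p).
  by rewrite rmorphD !rmorphM /= map_polyZ rmorphXn.
have e2 : l ^+ s' *: P = rdivp P Q * Q + rmodp P Q.
  by rewrite -lQ rdivp_eq.
have sr : (size (map_poly phi (rmodp p q)) < size Q)%N.
  by rewrite sQ (leq_ltn_trans (size_poly _ _)) // ltn_rmodp.
have sr' : (size (rmodp P Q) < size Q)%N by rewrite ltn_rmodp.
have e : l ^+ s' *: map_poly phi (rmodp p q) = l ^+ s *: rmodp P Q.
  have /(congr1 (fun u => u %% Q)) := congr1 (fun u => l ^+ s' *: u) e1.
  by rewrite scalerA mulrC -scalerA e2 !modpZl !modp_addl_mul_small.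
exists ((l ^+ s' / l ^+ s) ^+ 2); split.
  by rewrite exprn_even_gt0 // mulf_neq0 ?invr_eq0 ?expf_neq0.
rewrite /next_mod -/s -/s' lQ map_polyZ rmorphN rmorphXn -/l /=.
have -> : rmodp P Q = (l ^+ s' / l ^+ s) *: map_poly phi (rmodp p q).
  rewrite mulrC -scalerA e scalerA mulVf ?scale1r //.
  by rewrite expf_neq0.
rewrite !scalerA; congr (_ *: _); field.
by rewrite expf_neq0.
Qed.

(** Sturm's algorithm: after testing the leading coefficient of q, either q is
truncated or one division step is carried out over B, and in both cases the
size of the second polynomial decreases. *)
Lemma sign_determined_changes p q : sign_determined (fun F phi =>
  changes_mods (map_poly phi p) (map_poly phi q)).
Proof.
elim: {q}_.+1 {-2}q (ltnSn (size q)) p => // n IH q sq p.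
have [->|q0] := eqVneq q 0.
  apply: sign_determined_ext (sign_determined_const 0) => F phi.
  by rewrite map_poly0 changes_modsp0.
pose q' := take_poly (size q).-1 q.
pose r := - (lead_coef q ^+ rscalp p q) *: rmodp p q.
have sq' : (size q' < n)%N.
  apply: leq_ltn_trans (size_take_poly _ _) _.
  by move: sq q0; rewrite -size_poly_eq0; case: (size q).
have sr : (size r < n)%N.
  apply: leq_ltn_trans (size_scale_leq _ _) _.
  by apply: (@leq_trans (size q)) => //; rewrite ltn_rmodp.
pose k (s : int) : evaluation int := fun F phi =>
  if s == 0 then changes_mods (map_poly phi p) (map_poly phi q')
  else crossR (map_poly phi (p * q)) +
       changes_mods (map_poly phi q) (map_poly phi r).
have hk s : sign_determined (k s).
  rewrite /k; case: (s == 0); first exact: IH.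
  by apply: sign_determined_map2; [exact: sign_determined_crossR|exact: IH].
apply: sign_determined_ext (sign_determined_bind (sign_determined_sgz (lead_coef q)) hk).
move=> F phi; rewrite /k sgz_eq0; have [l0|l0] := eqVneq (phi (lead_coef q)) 0.
  by rewrite [map_poly phi q]map_take_poly.
have [c [c0 nm]] := next_mod_map p q0 l0.
by rewrite [RHS]changes_mods_rec nm changes_modsZ gtr0_sgz // mul1r rmorphM.
Qed.

Lemma sign_determined_taqR p q : sign_determined (fun F phi =>
  taqR (map_poly phi p) (map_poly phi q)).
Proof.
apply: sign_determined_ext (sign_determined_changes p (p^`() * q)) => F phi.
by rewrite /taqR deriv_map rmorphM.
Qed.

End SignDetermined.

(** * Roots subject to sign conditions *)

(** The products of the q ^ e with all exponents e in {1, 2}; their signs are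
summed in [sum_sgz_power_combinations]. *)
Fixpoint power_combinations (A : pzSemiRingType) (sq : seq A) : seq A :=
  if sq is q :: sq' then
    [seq q * c | c <- power_combinations sq'] ++
    [seq q ^+ 2 * c | c <- power_combinations sq']
  else [:: 1].

Lemma power_combinations_map (A A' : pzSemiRingType) (f : {rmorphism A -> A'})
    (sq : seq A) :
  power_combinations (map f sq) = map f (power_combinations sq).
Proof.
elim: sq => [|q sq IH] /=; first by rewrite rmorph1.
rewrite IH map_cat -!map_comp; congr (_ ++ _); apply: eq_map => c /=;
  by rewrite rmorphM ?rmorphXn.
Qed.

(** The sum is the product of the factors sgz q + sgz q ^ 2, each of which is 2 if
q is positive and 0 otherwise. *)
Lemma sum_sgz_power_combinations (F : rcfType) (sq : seq {poly F}) (x : F) :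
  \sum_(c <- power_combinations sq) sgz c.[x]
    = if all (fun q : {poly F} => 0 < q.[x]) sq then 2 ^+ size sq else 0.
Proof.
elim: sq => [|q sq IH] /=; first by rewrite big_seq1 hornerC sgz1.
rewrite big_cat !big_map /=.
rewrite [X in X + _](eq_bigr (fun c => sgz q.[x] * sgz c.[x])) => [|c _]; last first.
  by rewrite hornerM sgzM.
rewrite [X in _ + X](eq_bigr (fun c => sgz q.[x] ^+ 2 * sgz c.[x])) => [|c _]; last first.
  by rewrite hornerM horner_exp sgzM sgzX.
rewrite -!mulr_sumr IH -mulrDl.
case: sgzP => _ /=; rewrite ?sqrrN ?expr1n ?expr0n ?addr0 ?addNr ?mul0r //.
by case: ifP; rewrite ?mulr0 // [in RHS]exprS.
Qed.

Lemma taqR_power_combinations (F : rcfType) (p : {poly F}) (sq : seq {poly F}) :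
  p != 0 ->
  (0 < \sum_(c <- power_combinations sq) taqR p c) <->
  exists x, root p x && all (fun q : {poly F} => 0 < q.[x]) sq.
Proof.
move=> p0.
have -> : \sum_(c <- power_combinations sq) taqR p c = \sum_(x <- rootsR p)
    if all (fun q : {poly F} => 0 < q.[x]) sq then 2 ^+ size sq else 0.
  under eq_bigr do rewrite -taq_taqR /taq.
  by rewrite exchange_big; apply: eq_bigr => x _; rewrite sum_sgz_power_combinations.
have ge0 x : 0 <= (if all (fun q : {poly F} => 0 < q.[x]) sq
                   then 2 ^+ size sq else 0 : int).
  by case: ifP => // _; exact: exprn_ge0.
rewrite lt_def sumr_ge0 => [|x _]; last exact: ge0.
rewrite andbT psumr_neq0 => [|x _]; last exact: ge0.
split=> [/hasP[x]|[x /andP[rx qx]]].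
  rewrite -[x \in _]roots_on_rootsR //= => rx; case: ifP => // h _.
  by exists x; rewrite rx.
apply/hasP; exists x; first by rewrite -[x \in _]roots_on_rootsR.
by rewrite /= qx exprn_gt0.
Qed.

Section SignDeterminedRoot.
Variable B : comNzRingType.
Implicit Types (p : {poly B}) (sq : seq {poly B}).

(** When p does not vanish identically the roots are counted by Tarski queries.
When p vanishes, the q are all positive somewhere exactly when they are so near
one of the two infinities or at a critical point of their product. *)
Lemma sign_determined_common_root p sq :
  sign_determined (fun F (phi : {rmorphism B -> F}) =>
    `[< exists x, root (map_poly phi p) x /\
          {in sq, forall q, 0 < (map_poly phi q).[x]} >]).
Proof.
pose bq : {poly B} := (\prod_(q <- sq) q)^`().
pose cnt p : evaluation B int := fun F phi =>
  \sum_(c <- power_combinations sq) taqR (map_poly phi p) (map_poly phi c).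
have hcnt p' : sign_determined (cnt p').
  by apply: sign_determined_big => c; exact: sign_determined_taqR.
pose lead q : evaluation B (nat * int) := fun F phi =>
  (size (map_poly phi q), sgz (lead_coef (map_poly phi q))).
pose pinf : evaluation B bool := fun F phi =>
  \big[andb/true]_(q <- sq) (0 < (lead q F phi).2).
pose minf : evaluation B bool := fun F phi =>
  \big[andb/true]_(q <- sq)
    (0 < (-1) ^+ (lead q F phi).1.-1 * (lead q F phi).2).
have hlead q : sign_determined (lead q) by exact: sign_determined_lead.
have hpinf : sign_determined pinf.
  apply: sign_determined_big => q.
  exact: (sign_determined_map (fun u => 0 < u.2) (hlead q)).
have hminf : sign_determined minf.
  apply: sign_determined_big => q.
  exact: (sign_determined_map (fun u => 0 < (-1) ^+ u.1.-1 * u.2) (hlead q)).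
(* The critical points are roots of bq, and roots are only counted for nonzero
polynomials. *)
pose nonroot : evaluation B bool := fun F phi =>
  [|| pinf F phi, minf F phi |
     ((lead bq F phi).1 != 0%N) && (0 < cnt bq F phi)].
have hnonroot : sign_determined nonroot.
  apply: (sign_determined_map2 orb) => //.
  apply: (sign_determined_map2 orb) => //.
  apply: (sign_determined_map2 andb).
    exact: (sign_determined_map (fun u => u.1 != 0%N) (hlead bq)).
  exact: (sign_determined_map (fun u => 0 < u) (hcnt bq)).
pose k (s : nat) : evaluation B bool := fun F phi =>
  if s == 0%N then nonroot F phi else 0 < cnt p F phi.
have hk s : sign_determined (k s).
  rewrite /k; case: (s == 0%N) => //.
  exact: (sign_determined_map (fun u => 0 < u) (hcnt p)).
apply: sign_determined_ext
  (sign_determined_bind (sign_determined_map fst (hlead p)) hk) => F phi.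
have cntE r : cnt r F phi = \sum_(c <- power_combinations
    (map (map_poly phi) sq)) taqR (map_poly phi r) c.
  by rewrite power_combinations_map big_map.
have allE x : all (fun q : {poly F} => 0 < q.[x]) (map (map_poly phi) sq)
    <-> {in sq, forall q, 0 < (map_poly phi q).[x]}.
  by rewrite all_map; split=> /allP.
rewrite /k /= size_poly_eq0; apply/esym/asbool_equiv_eqP; first exact: idP.
have [p0|p0] := eqVneq (map_poly phi p) 0; last first.
  rewrite cntE; apply: (iff_trans _ (iff_sym (taqR_power_combinations _ p0))).
  split=> [[x [rx /allE qx]]|[x /andP[rx /allE qx]]]; exists x; last by split.
  by apply/andP.
have bqE : map_poly phi bq = bounding_poly (map (map_poly phi) sq).
  by rewrite /bounding_poly big_map -rmorph_prod deriv_map.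
have := ccount_gt0P [::] (map (map_poly phi) sq).
rewrite /ccount_gt0 big_nil eqxx /= -bqE => cP.
pose sq' := map (map_poly phi) sq.
set b := nonroot F phi.
have bE : b =
    [|| \big[andb/true]_(q <- sq') (0 < lead_coef q),
        \big[andb/true]_(q <- sq') (0 < (-1) ^+ (size q).-1 * lead_coef q)
      | 0 < ccount_weak (map_poly phi bq) sq'].
  rewrite /b /sq' /nonroot /pinf /minf /lead /= !big_map; congr [|| _, _ | _].
  - by apply: eq_bigr => q _; rewrite sgz_gt0.
  - apply: eq_bigr => q _; rewrite -signr_odd -[in RHS]signr_odd.
    by case: odd; rewrite ?mulN1r ?mul1r ?oppr_gt0 ?sgz_lt0 ?sgz_gt0.
  - rewrite size_poly_eq0; have [b0|b0] /= := eqVneq (map_poly phi bq) 0.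
      by rewrite b0 -constraints1P rootsR0 /constraints big_nil ltxx.
    rewrite cntE; apply/idP/idP.
      move=> /(taqR_power_combinations _ b0)[x /andP[rx /allP qx]].
      apply/ccount_weakP => //; exists x.
      by rewrite -rootE rx big_all; apply/allP.
    move=> /(ccount_weakP _ b0)[x]; rewrite -rootE big_all => rqx.
    by apply/(taqR_power_combinations _ b0); exists x.
rewrite bE; apply: (iff_trans _ (rwP cP)).
split=> [[x [_ /allE qx]]|[x]].
  by exists x; rewrite big_nil big_all.
rewrite big_nil big_all => /allE qx; exists x; split=> //.
by rewrite p0 root0.
Qed.

End SignDeterminedRoot.

(** * Transfer between real closed fields *)

Lemma mmap_muni (B : comNzRingType) (F : comNzRingType) (h : {rmorphism B -> F})
    n (x : 'I_n.+1 -> F) (g : {mpoly B[n.+1]}) :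
  let y i := x (widen_ord (leqnSn n) i) in
  mmap h x g = (map_poly (mmap h y) (muni g)).[x ord_max].
Proof.
move=> y; rewrite muniE rmorph_sum horner_sum; apply: eq_bigr => m _ /=.
rewrite map_polyZ map_polyXn hornerZ hornerXn /= mmapZ mmapX -mulrA; congr (_ * _).
rewrite /mmap1 big_ord_recr /=; congr (_ * _).
by apply: eq_bigr => i _; rewrite mnmE.
Qed.

Lemma mmap_nvar0 (B F : comNzRingType) (h : {rmorphism B -> F})
    (x : 'I_0 -> F) (g : {mpoly B[0]}) : mmap h x g = h g@_0.
Proof.
have {1}-> : g = (g@_0)%:MP.
  apply/mpolyP => m; have -> : m = 0%MM by apply/mnmP; case.
  by rewrite mcoeffC eqxx mulr1.
by rewrite mmapC.
Qed.

(** One coordinate at a time: view the polynomials of G as univariate over the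
polynomials in the first n variables. That some value of the last coordinate
realizes the prescribed signs is decided by a sign tree over these
coefficients, whose tests have, by induction, the same signs at some point y
over F as at the given point over F'. *)
Theorem sign_transfer (B : comNzRingType) (F F' : rcfType)
    (h : {rmorphism B -> F}) (h' : {rmorphism B -> F'}) :
    (forall b, sgz (h b) = sgz (h' b)) ->
  forall n (x' : 'I_n -> F') (G : seq {mpoly B[n]}),
  exists x : 'I_n -> F, {in G, forall g, sgz (mmap h x g) = sgz (mmap h' x' g)}.
Proof.
move=> hh'; elim=> [|n IH] x' G.
  by exists (fun=> 0) => g _; rewrite !mmap_nvar0.
pose y' i := x' (widen_ord (leqnSn n) i).
pose s g := sgz (mmap h' x' g).
(* All the equations at once, as a sum of squares. *)
pose p := \sum_(g <- G | s g == 0) muni g ^+ 2.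
pose sg_muni g := if 0 < s g then muni g else - muni g.
pose sq := [seq sg_muni g | g <- G & s g != 0].
have [t tP] := sign_determined_common_root p sq.
have [y yP] := IH y' (tree_tests t).
have mapE (E : rcfType) (k : {rmorphism B -> E}) (z : 'I_n -> E) g (u : E) :
    (map_poly (mmap k z) (sg_muni g)).[u] =
    if 0 < s g then (map_poly (mmap k z) (muni g)).[u]
    else - (map_poly (mmap k z) (muni g)).[u].
  by rewrite /sg_muni; case: ifP => _ //; rewrite rmorphN hornerN.
have pE (E : rcfType) (k : {rmorphism B -> E}) (z : 'I_n -> E) (u : E) :
    (map_poly (mmap k z) p).[u]
    = \sum_(g <- G | s g == 0) (map_poly (mmap k z) (muni g)).[u] ^+ 2.
  rewrite rmorph_sum horner_sum; apply: eq_bigr => g _.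
  by rewrite rmorphXn horner_exp.
have : run_tree (mmap h' y') t.
  rewrite tP; apply/asboolP; exists (x' ord_max); split.
    rewrite rootE pE big1 // => g /eqP sg.
    by rewrite -mmap_muni; move/eqP: sg; rewrite sgz_eq0 => /eqP ->; rewrite expr0n.
  move=> q /mapP[g]; rewrite mem_filter => /andP[sg _] ->.
  by rewrite mapE -mmap_muni; move: sg; rewrite /s; case: sgzP => // H _;
    rewrite /= ?oppr_gt0.
rewrite -(run_tree_agree yP) tP => /asboolP[u [ru qu]].
pose x (i : 'I_n.+1) := if insub (nat_of_ord i) is Some j then y j else u.
have xw : (fun i => x (widen_ord (leqnSn n) i)) = y.
  by apply/funext => i; rewrite /x /= valK.
have xm : x ord_max = u by rewrite /x insubF //= ltnn.
exists x => g gG; rewrite mmap_muni xw xm.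
have [sg|sg] := eqVneq (s g) 0.
  rewrite -/(s g) sg; move: ru; rewrite rootE pE psumr_eq0 => [|? _]; last exact: sqr_ge0.
  by move=> /allP /(_ g gG); rewrite sg eqxx /= sqrf_eq0 => /eqP ->; rewrite sgz0.
have : 0 < (map_poly (mmap h y) (sg_muni g)).[u].
  by apply: qu; apply: map_f; rewrite mem_filter sg.
rewrite mapE -/(s g); move: sg; rewrite /s; case: sgzP => // _ _ /= H.
  exact: gtr0_sgz.
by rewrite ltr0_sgz // -oppr_gt0.
Qed.

(** * The preordering of a system of constraints *)

Section PolynomialPreordering.
Variables (n : nat) (R : realType) (n1 n2 : nat).
Variables (g0 : 'I_n1 -> {mpoly R[n]}) (gp : 'I_n2 -> {mpoly R[n]}).
Implicit Types (p q s : {mpoly R[n]}).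

Lemma sos0 : sos (0 : {mpoly R[n]}).
Proof. by exists [::]; rewrite big_nil. Qed.

Lemma sosD p q : sos p -> sos q -> sos (p + q).
Proof. by move=> [r ->] [s ->]; exists (r ++ s); rewrite big_cat. Qed.

Lemma sos_sqr p : sos (p ^+ 2).
Proof. by exists [:: p]; rewrite big_seq1. Qed.

Lemma sosM p q : sos p -> sos q -> sos (p * q).
Proof.
move=> [r ->] [s ->]; exists [seq u * v | u <- r, v <- s].
rewrite big_allpairs_dep mulr_suml; apply: eq_bigr => u _.
by rewrite mulr_sumr; apply: eq_bigr => v _; rewrite exprMn.
Qed.

Lemma preordering_term e s : sos s -> preordering gp (gprod gp e * s).
Proof.
move=> hs; exists (fun e' => if e' == e then s else 0) => [e'|].
  by case: ifP => // _; exact: sos0.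
rewrite (bigD1 e) //= eqxx big1 ?addr0 // => e' /negPf ->.
by rewrite mulr0.
Qed.

Lemma preordering0 : preordering gp 0.
Proof.
exists (fun=> 0) => [e|]; first exact: sos0.
by rewrite big1 // => e _; rewrite mulr0.
Qed.

Lemma preorderingD p q :
  preordering gp p -> preordering gp q -> preordering gp (p + q).
Proof.
move=> [s hs ->] [s' hs' ->]; exists (fun e => s e + s' e) => [e|].
  exact: sosD.
by rewrite -big_split; apply: eq_bigr => e _; rewrite mulrDr.
Qed.

Lemma gprod0 : gprod gp [ffun=> false] = 1.
Proof. by rewrite /gprod big1 // => j _; rewrite ffunE. Qed.

(** A constraint occurring in both factors contributes a square. *)
Lemma gprodM e e' : gprod gp e * gprod gp e' =
  gprod gp [ffun j => e j (+) e' j] * gprod gp [ffun j => e j && e' j] ^+ 2.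
Proof.
rewrite /gprod -prodrXl -!big_split; apply: eq_bigr => j _ /=.
by rewrite !ffunE; case: (e j); case: (e' j);
  rewrite /= ?expr0 ?expr1 ?expr1n ?mulr1 ?mul1r.
Qed.

Lemma preordering_sos s : sos s -> preordering gp s.
Proof. by move=> hs; rewrite -[s]mul1r -gprod0; exact: preordering_term. Qed.

Lemma preorderingM p q :
  preordering gp p -> preordering gp q -> preordering gp (p * q).
Proof.
move=> [s hs ->] [s' hs' ->]; rewrite mulr_suml.
apply: (big_ind (preordering gp)) => [||e _].
- exact: preordering0.
- exact: preorderingD.
rewrite mulr_sumr; apply: (big_ind (preordering gp)) => [||e' _].
- exact: preordering0.
- exact: preorderingD.
rewrite mulrACA gprodM -mulrA; apply: preordering_term.
by apply: sosM; [exact: sos_sqr|exact: sosM].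
Qed.

(** The preordering generated by the inequalities and both signs of the
equations. *)
Definition ideal_preordering : set {mpoly R[n]} :=
  [set p | exists q (h : 'I_n1 -> {mpoly R[n]}),
     preordering gp q /\ p = q + \sum_i h i * g0 i].

Lemma ideal_preordering_cone : preorder_cone ideal_preordering.
Proof.
split.
- move=> p; exists (p ^+ 2), (fun=> 0); split.
    exact/preordering_sos/sos_sqr.
  by rewrite big1 ?addr0 // => i _; rewrite mul0r.
- move=> _ _ [q [h [hq ->]]] [q' [h' [hq' ->]]].
  exists (q + q'), (fun i => h i + h' i); split; first exact: preorderingD.
  by rewrite addrACA -big_split; congr (_ + _); apply: eq_bigr => i _; rewrite mulrDl.
- move=> _ _ [q [h [hq ->]]] [q' [h' [hq' ->]]].
  exists (q * q'), (fun i => (q' + \sum_i h' i * g0 i) * h i + q * h' i); split.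
    exact: preorderingM.
  under [in RHS]eq_bigr do rewrite mulrDl -!mulrA.
  by rewrite big_split -!mulr_sumr /=; ring.
Qed.

Lemma ideal_preordering_eq i :
  ideal_preordering (g0 i) /\ ideal_preordering (- g0 i).
Proof.
have hc c : ideal_preordering (c * g0 i).
  exists 0, (fun j => if j == i then c else 0); split; first exact: preordering0.
  rewrite add0r (bigD1 i) //= eqxx big1 ?addr0 // => j /negPf ->.
  by rewrite mul0r.
by split; [rewrite -[g0 i]mul1r|rewrite -mulN1r]; apply: hc.
Qed.

Lemma ideal_preordering_ineq j : ideal_preordering (gp j).
Proof.
exists (gp j), (fun=> 0); split; last first.
  by rewrite big1 ?addr0 // => i _; rewrite mul0r.
have -> : gp j = gprod gp [ffun k => k == j] * 1.
  rewrite mulr1 /gprod (bigD1 j) //= ffunE eqxx big1 ?mulr1 // => k /negPf kj.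
  by rewrite ffunE kj.
by apply: preordering_term; rewrite -(expr1n _ 2); exact: sos_sqr.
Qed.

(** Multiplying by p ^ 2 makes the exponent positive. *)
Lemma gradical_of_ideal_preordering p : (exists m, ideal_preordering (- p ^+ (2 * m))) ->
  gradical g0 gp p.
Proof.
move=> [m hm]; have Tc := ideal_preordering_cone.
have [q [h [hq e]]] := preorderM Tc (preorder_sqr Tc p) hm.
exists m.+1, q; split=> //; exists n1, g0, (fun i => - h i); split.
  by move=> i; exists i.
under eq_bigr do rewrite mulNr.
rewrite sumrN; move: e; rewrite mulrN -exprD => e.
by rewrite mulnS -[p ^+ _]opprK e opprD addrAC addNr add0r.
Qed.

Lemma gradical_vanishing p :
  gradical g0 gp p -> vanishing_ideal (semialg g0 gp) p.
Proof.
move=> [m [q [m0 [s hs ->] [r [b [a [hb e]]]]]]] x [x0 xp].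
have Z : (\sum_(i < r) a i * b i).@[x] = 0.
  rewrite raddf_sum big1 // => i _ /=.
  by have [j _ <-] := hb i; rewrite mevalM x0 mulr0.
have /eqP := congr1 (meval x) e; rewrite Z rmorphD rmorphXn /=.
rewrite paddr_eq0.
- by rewrite expf_eq0 => /andP[/andP[_ /eqP]].
- by rewrite mulnC exprM sqr_ge0.
- rewrite raddf_sum sumr_ge0 // => e' _ /=; rewrite mevalM mulr_ge0 //.
    rewrite /gprod rmorph_prod prodr_ge0 // => j _ /=.
    by rewrite rmorphXn /= exprn_ge0.
  have [u ->] := hs e'; rewrite raddf_sum sumr_ge0 // => v _ /=.
  by rewrite rmorphXn /= sqr_ge0.
Qed.

End PolynomialPreordering.

(** * The real Nullstellensatz *)

Lemma mpoly_code_inj (B : nzRingType) (code : B -> nat) n : injective code ->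
  injective (fun p : {mpoly B[n]} =>
    pickle [seq (m, code p@_m) | m <- msupp p]).
Proof.
move=> code_inj p q /(pcan_inj pickleK) e.
have supp : msupp p = msupp q.
  have fstK (s : seq 'X_{1..n}) (c : 'X_{1..n} -> nat) :
      unzip1 [seq (m, c m) | m <- s] = s by elim: s => //= m s ->.
  by have := congr1 unzip1 e; rewrite !fstK.
apply/mpolyP => m; have [mp|mp] := boolP (m \in msupp p); last first.
  by rewrite !memN_msupp_eq0 -?supp.
have : (m, code p@_m) \in [seq (m, code q@_m) | m <- msupp q].
  by rewrite -e; apply: map_f.
by move=> /mapP[m' _ [-> /code_inj ->]].
Qed.

Lemma rmorphism_mmap (B F : comNzRingType) n (f : {rmorphism {mpoly B[n]} -> F})
    (h : {rmorphism B -> F}) (x : 'I_n -> F) :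
    (forall b, f b%:MP = h b) -> (forall i, f 'X_i = x i) ->
  forall g, f g = mmap h x g.
Proof.
move=> fC fX; elim/mpolyind => [|c m p _ _ IH]; first by rewrite !rmorph0.
rewrite !rmorphD /= IH; congr (_ + _).
rewrite mmapZ mmapX -mul_mpolyC rmorphM fC; congr (_ * _).
rewrite mpolyXE_id rmorph_prod; apply: eq_bigr => i _.
by rewrite rmorphXn /= fX.
Qed.

(** B is the ring of integral polynomials with one variable for each coefficient
of the polynomials considered. *)
Lemma countable_coefficients n (R : realType) (ps : seq {mpoly R[n]}) :
  exists (B : comNzRingType) (code : B -> nat) (h : {rmorphism B -> R})
    (lift : {mpoly R[n]} -> {mpoly B[n]}),
  injective code /\ {in ps, cancel lift (map_mpoly h)}.
Proof.
pose cs := flatten [seq [seq p@_m | m <- msupp p] | p <- ps].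
pose N := size cs; pose c (i : 'I_N) := cs`_i.
pose B : comNzRingType := {mpoly int[N]}.
pose h : {rmorphism B -> R} := mmap (intr : {rmorphism int -> R}) c.
pose lift1 (r : R) : B := if insub (index r cs) is Some i then 'X_i else 0.
have lift1K r : r \in cs -> h (lift1 r) = r.
  move=> rcs; rewrite /lift1 insubT ?index_mem // => lt_i.
  by rewrite /h /= mmapX mmap1U /c /= nth_index.
exists B, (fun b => pickle [seq (m, pickle b@_m) | m <- msupp b]), h,
  (fun p => \sum_(m <- msupp p) lift1 p@_m *: 'X_[m]); split.
  exact: mpoly_code_inj (pcan_inj pickleK).
move=> p pps; rewrite rmorph_sum [RHS]mpolyE big_seq [RHS]big_seq.
apply: eq_bigr => m mp; rewrite /= map_mpolyZ map_mpolyX lift1K //.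
apply/flattenP; exists [seq p@_m | m <- msupp p]; apply: map_f => //.
Qed.

Section Positivstellensatz.
Variables (R : realType) (n n1 n2 : nat).
Variables (g0 : 'I_n1 -> {mpoly R[n]}) (gp : 'I_n2 -> {mpoly R[n]}).

(** The preordering on B[X] is the preimage of the real one, so it contains every
constant whose real value is nonnegative; hence the morphism h' to the
real closed field F gives every element of B the sign of its real value, and
the point x' of F can be transferred to a real point y of S where p is not
zero. *)
Theorem real_nullstellensatz :
  vanishing_ideal (semialg g0 gp) = gradical g0 gp.
Proof.
rewrite eqEsubset; split=> [p pS|p]; last exact: gradical_vanishing.
apply: contrapT => np.
pose ps := p :: [seq g0 i | i <- enum 'I_n1] ++ [seq gp j | j <- enum 'I_n2].
have [B [code [h [lift [code_inj liftK]]]]] := countable_coefficients ps.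
have pps : p \in ps by rewrite mem_head.
have g0ps i : g0 i \in ps by rewrite inE mem_cat map_f ?orbT // mem_enum.
have gpps j : gp j \in ps by rewrite inE mem_cat orbC map_f ?mem_enum ?orbT.
pose T : set {mpoly B[n]} := [set a | ideal_preordering g0 gp (map_mpoly h a)].
have Tc' := ideal_preordering_cone g0 gp.
have Tc : preorder_cone T.
  split=> [x|x y Tx Ty|x y Tx Ty]; rewrite /T /=.
  - by rewrite rmorphXn; exact: (preorder_sqr Tc').
  - by rewrite rmorphD; exact: (preorderD Tc').
  - by rewrite rmorphM; exact: (preorderM Tc').
pose M : set {mpoly B[n]} := [set s | exists m, s = lift p ^+ (2 * m)].
have [|s t [m ->] [m' ->]|s [m ->]|s [m ->] Ts|L [f [fT fM fsurj]]] :=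
  @ordered_field_point _ T M Tc.
- by exists 0%N.
- by exists (m + m')%N; rewrite mulnDr exprD.
- by rewrite mulnC exprM; exact: (preorder_sqr Tc).
- apply: np; apply: gradical_of_ideal_preordering; exists m.
  by move: Ts; rewrite /T /= rmorphN rmorphXn /= liftK.
have /choice[num /choice[den fE]] : forall z, exists a b, f b != 0 /\ z = f a / f b.
  exact: fsurj.
pose codeA (a : {mpoly B[n]}) := pickle [seq (m, code a@_m) | m <- msupp a].
have codeA_inj : injective codeA := mpoly_code_inj code_inj.
have codeL_inj : injective (fun z => pickle (codeA (num z), codeA (den z))).
  move=> z z' /(pcan_inj pickleK)[/codeA_inj nE /codeA_inj dE].
  by rewrite (fE z).2 (fE z').2 nE dE.
have [F [i i0]] := countable_real_closure codeL_inj.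
pose fi : {rmorphism {mpoly B[n]} -> F} := i \o f.
pose h' : {rmorphism B -> F} := fi \o (@mpolyC n B).
pose x' j := fi 'X_j.
have fiE : forall g, fi g = mmap h' x' g by apply: rmorphism_mmap.
have fi_ge0 a : T a -> 0 <= fi a by move=> Ta; apply/i0/fT.
have h'_ge0 b : 0 <= h b -> 0 <= h' b.
  move=> hb; apply: fi_ge0; rewrite /T /= map_mpolyC.
  rewrite (_ : _%:MP = (Num.sqrt (h b))%:MP ^+ 2); first exact: (preorder_sqr Tc').
  by rewrite -rmorphXn /= sqr_sqrtr.
have h'_gt0 b : 0 < h b -> 0 < h' b.
  (* Only weak signs are given by T; strictness comes from k b >= 1. *)
  move=> hb; pose k := Num.bound (h b)^-1.
  have hk : 1 <= h (b *+ k).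
    rewrite rmorphMn -mulr_natl.
    have := archi_boundP (ltW (eqbRL (invr_gt0 (h b)) hb)); rewrite -/k => /ltW.
    by rewrite -ler_pdivrMr // div1r.
  have : 0 <= h' (b *+ k - 1) by apply: h'_ge0; rewrite rmorphB rmorph1 subr_ge0.
  rewrite rmorphB rmorph1 subr_ge0 rmorphMn => h1.
  have := lt_le_trans ltr01 h1.
  by case: (k) => [|k']; rewrite ?mulr0n ?ltxx // pmulrn_lgt0.
have hh' b : sgz (h b) = sgz (h' b).
  case: (sgzP (h b)) => hb.
  - suff -> : h' b = 0 by rewrite sgz0.
    apply/eqP; rewrite eq_le h'_ge0 ?hb // andbT -oppr_ge0 -rmorphN.
    by rewrite h'_ge0 // rmorphN hb oppr0.
  - by rewrite gtr0_sgz // h'_gt0.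
  - by rewrite ltr0_sgz // -oppr_gt0 -rmorphN h'_gt0 // rmorphN oppr_gt0.
have [y yP] := sign_transfer hh' x' (map lift ps).
have evE q : q \in ps -> sgz q.@[y] = sgz (fi (lift q)).
  move=> qps; rewrite fiE -yP ?map_f // -{1}(liftK _ qps).
  pose ev : {rmorphism {mpoly B[n]} -> R} := meval y \o map_mpoly h.
  congr sgz; apply: (rmorphism_mmap (f := ev)) => [b|j].
    by rewrite /ev /= map_mpolyC mevalC.
  by rewrite /ev /= map_mpolyX mevalXU.
have yS : semialg g0 gp y.
  split=> [j|j].
    apply/eqP; rewrite -sgz_eq0 evE //.
    have [h1 h2] := ideal_preordering_eq g0 gp j.
    suff -> : fi (lift (g0 j)) = 0 by rewrite sgz0.
    apply/eqP; rewrite eq_le fi_ge0 ?andbT; last by rewrite /T /= liftK.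
    by rewrite -oppr_ge0 -rmorphN fi_ge0 // /T /= rmorphN /= liftK.
  rewrite -sgz_ge0 evE // sgz_ge0 fi_ge0 // /T /= liftK //.
  exact: ideal_preordering_ineq.
have /eqP := pS y yS; rewrite -sgz_eq0 evE // sgz_eq0 fmorph_eq0.
have : f (lift p ^+ (2 * 1)) != 0 by apply: fM; exists 1%N.
by rewrite rmorphXn expf_eq0 /= => /negPf ->.
Qed.

End Positivstellensatz.

(** * The Hilbert basis theorem *)

(** The subsequence visits minimizers of a over successive tails. *)
Lemma nondecreasing_subsequence (a : nat -> nat) :
  exists2 s : nat -> nat, {homo s : i j / (i < j)%N}
    & {homo a \o s : i j / (i <= j)%N}.
Proof.
have /choice[mu muP] : forall N, exists j,
    (N <= j)%N /\ forall k, (N <= k)%N -> (a j <= a k)%N.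
  move=> N; have exv : exists v, `[< exists j, (N <= j)%N /\ a j = v >].
    by exists (a N); apply/asboolP; exists N.
  case: (ex_minnP exv) => v /asboolP[j [Nj <-]] minv.
  by exists j; split=> // k Nk; apply: minv; apply/asboolP; exists k.
pose fix s i := if i is i'.+1 then mu (s i').+1 else mu 0%N.
have sS i : (s i < s i.+1)%N by exact: (muP (s i).+1).1.
exists s.
  by apply: homo_ltn => //; exact: ltn_trans.
apply: homo_leq => [?||i]; [exact: leqnn|exact: leq_trans|].
have [N [sN Ns]] : exists N, s i = mu N /\ (N <= s i.+1)%N.
  case: i => [|i]; first by exists 0%N.
  by exists (s i).+1; split=> //; exact: ltn_trans (sS i) (sS i.+1).
by have := (muP N).2 _ Ns; rewrite -sN.
Qed.

Lemma dickson n (m : nat -> 'X_{1..n}) : exists i j, (i < j)%N /\ (m i <= m j)%MM.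
Proof.
have sub k : (k <= n)%N -> exists2 s : nat -> nat, {homo s : i j / (i < j)%N}
    & forall l : 'I_n, (l < k)%N -> {homo (fun i => m (s i) l) : i j / (i <= j)%N}.
  elim: k => [_|k IH kn]; first by exists id.
  have [s s_incr sP] := IH (ltnW kn).
  have [u u_incr uP] := nondecreasing_subsequence (fun i => m (s i) (Ordinal kn)).
  exists (s \o u) => [i j ij /=|l]; first exact/s_incr/u_incr.
  rewrite ltnS leq_eqVlt => /orP[/eqP lk|lk] i j ij /=.
    by have -> : l = Ordinal kn by [exact: val_inj]; apply: uP.
  apply: (sP l lk); move: ij; rewrite leq_eqVlt => /orP[/eqP ->//|ij].
  exact/ltnW/u_incr.
have [s s_incr sP] := sub n (leqnn n).
exists (s 0%N), (s 1%N); split; first exact: s_incr.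
by apply/mnm_lepP => l; apply: (sP l).
Qed.

Section HilbertBasis.
Variables (n : nat) (R : realType).
Implicit Types (p q : {mpoly R[n]}) (B : set {mpoly R[n]}).

Lemma ideal_gen0 B : ideal_gen B 0.
Proof.
by exists 0%N, (fun=> 0), (fun=> 0); split; [case|rewrite big_ord0].
Qed.

Lemma ideal_gen_mem B a b : B b -> ideal_gen B (a * b).
Proof.
by move=> Bb; exists 1%N, (fun=> b), (fun=> a); rewrite big_ord1.
Qed.

Lemma ideal_genD B p q : ideal_gen B p -> ideal_gen B q -> ideal_gen B (p + q).
Proof.
move=> [r [b [a [hb ->]]]] [r' [b' [a' [hb' ->]]]].
pose glue (u : 'I_r -> {mpoly R[n]}) (u' : 'I_r' -> {mpoly R[n]}) i :=
  match split i with inl j => u j | inr j => u' j end.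
exists (r + r')%N, (glue b b'), (glue a a'); split.
  by move=> i; rewrite /glue; case: split.
rewrite big_split_ord /glue; congr (_ + _); apply: eq_bigr => i _.
  by case: splitP => j e; [congr (a _ * b _); exact: val_inj|
    have := ltn_ord i; rewrite [X in (X < _)%N]e ltnNge leq_addr].
case: splitP => j /= e; first by have := ltn_ord j; rewrite -e ltnNge leq_addr.
by congr (a' _ * b' _); apply: val_inj; apply/eqP; rewrite -(eqn_add2l r) e.
Qed.

(** If I were not finitely generated, one could choose forever an element of I
outside the ideal of the previous choices, with least leading monomial. By
Dickson's lemma the leading monomial of some choice divides that of a later
one, whose leading term could then be cancelled, against minimality. *)
Theorem hilbert_basis (I : set {mpoly R[n]}) :
    (forall p q, I p -> I q -> I (p + q)) -> (forall c p, I p -> I (c * p)) ->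
  exists2 s : seq {mpoly R[n]}, {in s, forall f, I f}
    & I `<=` ideal_gen [set f | f \in s].
Proof.
move=> ID IM; apply: contrapT => nfg.
pose outside (s : seq {mpoly R[n]}) p := I p /\ ~ ideal_gen [set f | f \in s] p.
have /choice[next nextP] : forall s : seq {mpoly R[n]}, exists p,
    {in s, forall f, I f} -> outside s p /\
    forall q, outside s q -> ~ (mlead q < mlead p)%O.
  move=> s; have [sI|nsI] := pselect {in s, forall f, I f}; last by exists 0.
  have [p0 outp0] : exists p, outside s p.
    apply: contrapT => nout; apply: nfg; exists s => // p Ip.
    by apply: contrapT => np; apply: nout; exists p.
  move: {1}(mlead p0) (erefl (mlead p0)) => m; elim/(ltmwf (n := n)): m p0 outp0.
  move=> m IH p outp mp; apply: contrapT => nex.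
  have [q [outq ltq]] : exists q, outside s q /\ (mlead q < mlead p)%O.
    apply: contrapT => nq; apply: nex; exists p => _; split=> // q outq ltq.
    by apply: nq; exists q.
  by apply: nex; rewrite -mp in ltq; apply: (IH _ ltq q outq).
pose fix L k := if k is k'.+1 then next (L k') :: L k' else [::].
pose f k := next (L k).
have LI k : {in L k, forall g, I g}.
  elim: k => // k IH g; rewrite inE => /orP[/eqP ->|]; last exact: IH.
  exact: (nextP _ IH).1.1.
have fL i j : (i < j)%N -> f i \in L j.
  elim: j => // j IH; rewrite ltnS leq_eqVlt inE => /orP[/eqP ->|/IH ->].
    by rewrite eqxx.
  by rewrite orbT.
have [i [j [ij mij]]] := dickson (fun k => mlead (f k)).
have [[fjI fjout] fjmin] := nextP _ (LI j); rewrite -/(f j) in fjI fjout fjmin.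
have fi0 : f i != 0.
  have [[_ fiout] _] := nextP _ (LI i).
  by apply/eqP => fi0; apply: fiout; rewrite -/(f i) fi0; exact: ideal_gen0.
pose c := mleadc (f j) / mleadc (f i).
pose u := c *: 'X_[mlead (f j) - mlead (f i)].
have ufi : ideal_gen [set g | g \in L j] (u * f i).
  by apply: ideal_gen_mem; apply: fL.
have lc_ufi : (u * f i)@_(mlead (f j)) = mleadc (f j).
  have := mcoeffMX (f i) (mlead (f j) - mlead (f i)) (mlead (f i)).
  rewrite submK // mulrC => e; rewrite -scalerAl mcoeffZ e divfK //.
  by rewrite mleadc_eq0.
have le_ufi : (mlead (u * f i) <= mlead (f j))%O.
  rewrite -scalerAl; apply: le_trans (mleadZ_le _ _) _.
  by apply: le_trans (mleadM_le _ _) _; rewrite mleadXm submK.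
have back : ~ ideal_gen [set g | g \in L j] (f j - u * f i).
  by move=> h; apply: fjout; rewrite -[f j](subrK (u * f i)); apply: ideal_genD.
apply: (fjmin (f j - u * f i)).
  split=> //; rewrite -mulNr; apply: (ID _ _ fjI); apply: IM.
  exact: (LI j _ (fL _ _ ij)).
rewrite lt_neqAle; apply/andP; split.
  apply/eqP => e; apply: back.
  have : (f j - u * f i)@_(mlead (f j - u * f i)) = 0.
    by rewrite e mcoeffB lc_ufi subrr.
  by move=> /eqP; rewrite mleadc_eq0 => /eqP ->; exact: ideal_gen0.
by apply: le_trans (mleadB_le _ _) _; rewrite leUx lexx.
Qed.

End HilbertBasis.

(** * Kernels of moment operators *)

Section MomentKernel.
Variables (n : nat) (R : realType) (n1 n2 : nat).
Variables (g0 : 'I_n1 -> {mpoly R[n]}) (gp : 'I_n2 -> {mpoly R[n]}).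

Lemma degle_le (a b : int) (p : {mpoly R[n]}) : a <= b -> p \in degle a -> p \in degle b.
Proof.
by move=> ab /degleP h; apply/degleP => m /h h'; exact: le_trans h' ab.
Qed.

Lemma degle_exp (d : nat) (p : {mpoly R[n]}) k :
  p \in degle d -> p ^+ k \in degle (d * k)%N.
Proof.
move=> pd; elim: k => [|k IH]; first by rewrite expr0; exact: degle1.
by rewrite exprS mulnS PoszD; apply: degleM.
Qed.

Lemma mpdeg_degle (p : {mpoly R[n]}) : p \in degle (mpdeg p).
Proof. by rewrite degle_mpdeg lexx orbT. Qed.

Variable t : nat.
Implicit Types (L : 'Hom(polyle n R (2 * t), R^o)) (u v : polyle n R t).

Lemma trunc_preordering_sqr (q : {mpoly R[n]}) :
  q \in degle t -> trunc_preordering g0 gp t (q ^+ 2).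
Proof.
move=> qt; exists (fun=> 0), (fun e => if e == [ffun=> false] then q ^+ 2 else 0).
split=> [i|e|].
- exact: rpred0.
- case: eqP => [->|_]; last by exists [::]; rewrite ?big_nil.
  exists [:: q]; rewrite ?big_seq1 // => _ /[!inE] /eqP ->.
  by rewrite gprod0 /mpdeg msize1 subr0.
- rewrite big1 ?add0r => [|i _]; last by rewrite mulr0.
  rewrite (bigD1 [ffun=> false]) //= eqxx gprod0 mul1r big1 ?addr0 // => e /negPf ->.
  by rewrite mulr0.
Qed.

Lemma moment_cone_sqr_ge0 L u : moment_cone g0 gp L -> 0 <= L (polyleM u u) :> R.
Proof.
move=> [Lpos _]; apply: Lpos => /=; rewrite -expr2.
by apply: trunc_preordering_sqr; exact: valP.
Qed.

Lemma lker_moment_op L u :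
  reflect (forall v, L (polyleM u v) = 0) (u \in lker (moment_op L)).
Proof.
rewrite memv_ker; apply: (iffP eqP) => [h v|h].
  by rewrite -moment_opE h zero_lfunE.
by apply/lfunP => v; rewrite moment_opE h zero_lfunE.
Qed.

(** Cauchy-Schwarz: the value at v + c u is affine in c when L (u ^ 2) = 0, so it
can be nonnegative for all c only if L (u v) = 0. *)
Lemma lker_moment_sqr L u : moment_cone g0 gp L ->
  reflect (L (polyleM u u) = 0) (u \in lker (moment_op L)).
Proof.
move=> Lc; apply: (iffP (lker_moment_op L u)) => [//|Luu v].
apply/eqP/negPn/negP => b0; set b : R := L (polyleM u v) in b0.
(* Chosen so that L ((v + c u) ^ 2) = - 1. *)
pose c : R := - (L (polyleM v v) + 1) / (2 * b).
have := moment_cone_sqr_ge0 (v + c *: u) Lc.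
have -> : polyleM (v + c *: u) (v + c *: u)
    = polyleM v v + (2 * c) *: polyleM u v + c ^+ 2 *: polyleM u u.
  apply: val_inj => /=; rewrite -!mul_mpolyC.
  by rewrite expr2 !mpolyCM mpolyC_nat; ring.
rewrite !linearD !linearZ /= Luu scaler0 addr0 -/b.
have -> : (2 * c) *: (b : R^o) = - (L (polyleM v v) + 1).
  by rewrite /c /GRing.scale /=; field.
by rewrite opprD addrA subrr add0r oppr_ge0 ler10.
Qed.

(** If f ^ (k + 2) is in the kernel then L (f ^ (2k + 2)) = L (f ^ (k + 2) f ^ k)
vanishes, so f ^ (k + 1) is in the kernel as well. *)
Lemma moment_ker_root L (f : {mpoly R[n]}) (d m : nat) : moment_cone g0 gp L ->
    f \in degle d -> (d * m.+1 <= t)%N ->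
    (forall p : polyle n R (2 * t), val p = f ^+ (2 * m.+1) -> L p = 0) ->
  moment_ker L f.
Proof.
move=> Lc fd dm Lf.
have ft k : (k <= m.+1)%N -> f ^+ k \in degle t.
  move=> km; apply: degle_le (degle_exp k fd).
  by rewrite lez_nat (leq_trans _ dm) // leq_mul2l km orbT.
pose F k (km : (k <= m.+1)%N) : polyle n R t := exist _ (f ^+ k) (ft k km).
have step k (km : (k <= m.+1)%N) : (0 < k)%N -> F k km \in lker (moment_op L) ->
    moment_ker L f.
  elim: k km => // -[|k] IH km _ Fk.
    by exists (F 1%N km) => //=; rewrite expr1.
  have km' := ltnW km; have km'' := ltnW km'.
  apply: (IH km') => //; apply/(lker_moment_sqr _ Lc).
  have /(_ (F k km'')) := lker_moment_op _ _ Fk.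
  by move=> <-; congr (L _); apply: val_inj; rewrite /= -!exprD addSnnS addnC.
apply: (step m.+1 (leqnn _)) => //; apply/(lker_moment_sqr _ Lc).
by apply: Lf; rewrite /= -exprD addnn ssrnat.mul2n.
Qed.

Section PointEvaluation.
Variable x : 'I_n -> R.

Definition point_form (p : polyle n R (2 * t)) : R^o := (val p).@[x].

Lemma point_form_linear : linear point_form.
Proof.
by move=> c p q; rewrite /point_form /= mevalD mevalZ.
Qed.

HB.instance Definition _ :=
  GRing.isLinear.Build R (polyle n R (2 * t)) R^o *:%R point_form point_form_linear.

Lemma point_formE p : linfun point_form p = (val p).@[x] :> R.
Proof. by rewrite lfunE. Qed.

Lemma point_form_cone : semialg g0 gp x -> moment_cone g0 gp (linfun point_form).
Proof.
move=> [x0 xp]; split=> [p [h [s [_ hs e]]]|]; last first.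
  by rewrite point_formE /= meval1.
rewrite point_formE e rmorphD !raddf_sum /= big1 ?add0r => [|i _]; last first.
  by rewrite mevalM x0 mul0r.
apply: sumr_ge0 => e' _; rewrite mevalM mulr_ge0 //.
  rewrite /gprod rmorph_prod prodr_ge0 // => j _ /=.
  by rewrite rmorphXn /= exprn_ge0.
have [r _ ->] := hs e'; rewrite raddf_sum sumr_ge0 // => q _ /=.
by rewrite rmorphXn /= sqr_ge0.
Qed.

End PointEvaluation.

Lemma moment_cone_midpoint L L' : moment_cone g0 gp L -> moment_cone g0 gp L' ->
  moment_cone g0 gp (2^-1 *: (L + L')).
Proof.
move=> [Lpos L1] [Lpos' L1']; split=> [p hp|]; rewrite scale_lfunE add_lfunE.
  by apply: mulr_ge0; rewrite ?invr_ge0 ?ler0n // addr_ge0 ?Lpos ?Lpos'.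
by rewrite L1 L1' /GRing.scale /=; field.
Qed.

Lemma lker_midpoint L L' u : moment_cone g0 gp L -> moment_cone g0 gp L' ->
  u \in lker (moment_op (2^-1 *: (L + L'))) ->
  u \in lker (moment_op L) /\ u \in lker (moment_op L').
Proof.
move=> Lc Lc' /(lker_moment_sqr _ (moment_cone_midpoint Lc Lc')).
rewrite scale_lfunE add_lfunE => /eqP.
rewrite /GRing.scale /= mulf_eq0 invr_eq0 pnatr_eq0 /=.
rewrite paddr_eq0 ?(moment_cone_sqr_ge0 _ Lc) ?(moment_cone_sqr_ge0 _ Lc') //.
by move=> /andP[/eqP h /eqP h']; split; apply/lker_moment_sqr.
Qed.

(** The kernel at the midpoint of L and L' is contained in both kernels, and is
not smaller than that of L because the rank at L is maximal. *)
Lemma optimal_lker_sub L L' : optimal_for_0 g0 gp L -> moment_cone g0 gp L' ->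
  (lker (moment_op L) <= lker (moment_op L'))%VS.
Proof.
move=> [Lc opt] Lc'; pose N := 2^-1 *: (L + L').
have Nc : moment_cone g0 gp N by exact: moment_cone_midpoint.
have NL : (lker (moment_op N) <= lker (moment_op L))%VS.
  by apply/subvP => u /(lker_midpoint Lc Lc')[].
have dimE (K : 'Hom(polyle n R (2 * t), R^o)) :
    (\dim (lker (moment_op K)) + moment_rank K)%N = \dim {:polyle n R t}.
  by rewrite /moment_rank -(limg_ker_dim (moment_op K) fullv) capfv.
have /eqP <- : lker (moment_op N) == lker (moment_op L).
  rewrite eqEdim NL /= -(leq_add2r (moment_rank N)) dimE -(dimE L) leq_add2l.
  exact: opt.
by apply/subvP => u /(lker_midpoint Lc Lc')[].
Qed.

Lemma optimal_moment_ker_vanishing L : optimal_for_0 g0 gp L ->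
  moment_ker L `<=` vanishing_ideal (semialg g0 gp).
Proof.
move=> Lopt _ [u uL <-] x xS.
have /subvP/(_ u uL)/lker_moment_op := optimal_lker_sub Lopt (point_form_cone xS).
by move=> /(_ (polyle1 t)); rewrite point_formE /= mulr1.
Qed.

End MomentKernel.

(** * Forms of large order *)

Section LargeOrder.
Variables (n : nat) (R : realType) (n1 n2 : nat).
Variables (g0 : 'I_n1 -> {mpoly R[n]}) (gp : 'I_n2 -> {mpoly R[n]}).

Lemma degle_eventually (c : nat) (p : {mpoly R[n]}) (t : nat) :
  (mpdeg p + c <= t)%N -> p \in degle (t%:Z - c%:Z).
Proof. by move=> h; apply: degle_le (mpdeg_degle p); lia. Qed.

Lemma trunc_preordering_eventually (h : 'I_n1 -> {mpoly R[n]})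
    (s : {ffun 'I_n2 -> bool} -> {mpoly R[n]}) : (forall e, sos (s e)) ->
  exists t0, forall t, (t0 <= t)%N ->
    trunc_preordering g0 gp t (\sum_i g0 i * h i + \sum_e gprod gp e * s e).
Proof.
move=> /choice[r sE].
pose a i := (mpdeg (h i) + mpdeg (g0 i))%N.
pose b e (q : {mpoly R[n]}) := (mpdeg q + uphalf (mpdeg (gprod gp e)))%N.
exists (\sum_i a i + \sum_e \sum_(q <- r e) b e q)%N => t tP.
exists h, s; split=> // [i|e].
  apply: degle_eventually; rewrite ssrnat.mul2n -addnn.
  have : (a i <= t)%N.
    apply: leq_trans tP; apply: leq_trans (leq_addr _ _).
    by rewrite (bigD1 i) //= leq_addr.
  by rewrite /a => ai; apply: leq_trans ai (leq_addr _ _).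
exists (r e) => // q qr; apply: degle_eventually.
apply: leq_trans tP; apply: leq_trans (leq_addl _ _).
rewrite (bigD1 e) //=; apply: leq_trans (leq_addr _ _).
by rewrite (big_rem q) //= leq_addr.
Qed.

Lemma ideal_gen_rangeP (p : {mpoly R[n]}) : ideal_gen (range g0) p ->
  exists h : 'I_n1 -> {mpoly R[n]}, p = \sum_i g0 i * h i.
Proof.
move=> [r [b [a [hb ->]]]].
have /choice[idx bE] : forall i, exists j, g0 j = b i.
  by move=> i; have [j _ e] := hb i; exists j.
exists (fun j => \sum_(i < r | idx i == j) a i).
rewrite (partition_big idx predT) //=; apply: eq_bigr => j _.
rewrite mulr_sumr; apply: eq_bigr => i /eqP ij.
by rewrite -bE ij mulrC.
Qed.

(** For t large, both f ^ (2m) and its opposite, rewritten through the identity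
that puts f in the radical, belong to the truncated preordering. *)
Lemma gradical_moment_ker (f : {mpoly R[n]}) : gradical g0 gp f ->
  exists t0, forall t, (t0 <= t)%N ->
    forall L : 'Hom(polyle n R (2 * t), R^o),
      moment_cone g0 gp L -> moment_ker L f.
Proof.
move=> [m [q [m0 [s hs qE] /ideal_gen_rangeP[h e]]]].
case: m m0 e => // m _ e.
have [t1 t1P] := trunc_preordering_eventually (fun i => - h i) hs.
exists (t1 + mpdeg f * m.+1)%N => t tP L Lc.
have t1t : (t1 <= t)%N by apply: leq_trans tP; rewrite leq_addr.
have dt : (mpdeg f * m.+1 <= t)%N by apply: leq_trans tP; rewrite leq_addl.
apply: (moment_ker_root (d := mpdeg f) (m := m) Lc) => // [|p pE].
  exact: mpdeg_degle.
have fm : f ^+ m.+1 \in degle t.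
  by apply: degle_le (degle_exp _ (mpdeg_degle f)); rewrite lez_nat.
apply/eqP; rewrite eq_le; apply/andP; split.
  rewrite -oppr_ge0 (_ : - _ = L (- p)); last by rewrite linearN.
  apply: Lc.1 => /=.
  suff -> : - val p = \sum_i g0 i * - h i + \sum_e gprod gp e * s e by exact: t1P.
  rewrite pE -qE; under eq_bigr do rewrite mulrN.
  by rewrite sumrN -e opprD addrNK.
apply: Lc.1; rewrite pE mulnC exprM; exact: trunc_preordering_sqr.
Qed.

End LargeOrder.

Theorem theorem6p9 (R : realType) (n n1 n2 : nat)
    (g0 : 'I_n1 -> {mpoly R[n]}) (gp : 'I_n2 -> {mpoly R[n]}) :
  exists t2 : nat, forall t : nat, (t2 <= t)%N ->
    forall L : 'Hom(polyle n R (2 * t), R^o),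
      optimal_for_0 g0 gp L ->
      ideal_gen (moment_ker L) = vanishing_ideal (semialg g0 gp) /\
      vanishing_ideal (semialg g0 gp) = gradical g0 gp.
Proof.
set I := vanishing_ideal (semialg g0 gp).
have Irad : I = gradical g0 gp := real_nullstellensatz g0 gp.
have [f g fI gI x xS|c f fI x xS|s sI Is] := @hilbert_basis n R I.
- by rewrite mevalD fI // gI // addr0.
- by rewrite mevalM fI // mulr0.
have /choice[t0 t0P] : forall f, exists t0, I f -> forall t, (t0 <= t)%N ->
    forall L : 'Hom(polyle n R (2 * t), R^o),
      moment_cone g0 gp L -> moment_ker L f.
  move=> f; have [fI|nfI] := pselect (I f); last by exists 0%N.
  by have [|t0 t0P] := @gradical_moment_ker _ _ _ _ g0 gp f; [rewrite -Irad|exists t0].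
exists (\sum_(f <- s) t0 f)%N => t tP L Lopt; split=> //.
rewrite eqEsubset; split=> [_ [r [b [a [hb ->]]]] x xS|p /Is].
  rewrite raddf_sum big1 // => i _ /=.
  by rewrite mevalM (optimal_moment_ker_vanishing Lopt (hb i)) // mulr0.
move=> [r [b [a [hb ->]]]]; exists r, b, a; split=> // i.
apply: t0P (sI _ (hb i)) _ _ _ (Lopt.1).
by apply: leq_trans tP; rewrite (big_rem (b i)) ?leq_addr //; exact: hb.
Qed.
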